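(* Let $3\leq d_A\leq d_B\leq d_C$ be integers and consider $\mathbb{C}^{d_A}\otimes\mathbb{C}^{d_B}\otimes\mathbb{C}^{d_C}$. For any integer $n$ with $0\leq n\leq\lfloor (d_A-3)/2\rfloor$, the set $\mathcal{U}_n=\bigcup_{t=0}^{n}\Big(\bigcup_{i=1}^{3}(\mathcal{A}_i^{(t)}\cup\mathcal{B}_i^{(t)})\Big)\cup\mathcal{F}^{(n)}\cup\{|S\rangle\}$ defined in the context is a strongly nonlocal unextendible product basis of size $d_Ad_Bd_C-8(n+1)$.
   Context: $\{|0\rangle,\dots,|d_X-1\rangle\}$ is the computational basis of party $X\in\{A,B,C\}$, $\mathbb{Z}_m=\{0,1,\dots,m-1\}$, $w_m=e^{2\pi\sqrt{-1}/m}$. For an integer $t\ge 0$ and $X\in\{A,B,C\}$ let $X_t=d_X-2t$, and define $|\eta_s^{(t)}\rangle_X=\sum_{r=t}^{X_t+t-2}w_{X_t-1}^{s(r-t)}|r\rangle_X$ and $|\xi_s^{(t)}\rangle_X=\sum_{r=t}^{X_t+t-2}w_{X_t-1}^{s(r-t)}|r+1\rangle_X$ for $s\in\mathbb{Z}_{X_t-1}$, and $|\beta_s^{(t)}\rangle_X=\sum_{r=t}^{X_t+t-3}w_{X_t-2}^{s(r-t)}|r+1\rangle_X$ for $s\in\mathbb{Z}_{X_t-2}$. Define $\mathcal{A}_1^{(t)}=\{|\xi_i^{(t)}\rangle_A|t\rangle_B|\eta_k^{(t)}\rangle_C:(i,k)\in\mathbb{Z}_{A_t-1}\times\mathbb{Z}_{C_t-1}\setminus\{(0,0)\}\}$,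 $\mathcal{A}_2^{(t)}=\{|\xi_i^{(t)}\rangle_A|\eta_j^{(t)}\rangle_B|d_C-1-t\rangle_C:(i,j)\in\mathbb{Z}_{A_t-1}\times\mathbb{Z}_{B_t-1}\setminus\{(0,0)\}\}$, $\mathcal{A}_3^{(t)}=\{|d_A-1-t\rangle_A|\xi_j^{(t)}\rangle_B|\eta_k^{(t)}\rangle_C:(j,k)\in\mathbb{Z}_{B_t-1}\times\mathbb{Z}_{C_t-1}\setminus\{(0,0)\}\}$, $\mathcal{B}_1^{(t)}=\{|\eta_i^{(t)}\rangle_A|d_B-1-t\rangle_B|\xi_k^{(t)}\rangle_C:(i,k)\in\mathbb{Z}_{A_t-1}\times\mathbb{Z}_{C_t-1}\setminus\{(0,0)\}\}$, $\mathcal{B}_2^{(t)}=\{|\eta_i^{(t)}\rangle_A|\xi_j^{(t)}\rangle_B|t\rangle_C:(i,j)\in\mathbb{Z}_{A_t-1}\times\mathbb{Z}_{B_t-1}\setminus\{(0,0)\}\}$, $\mathcal{B}_3^{(t)}=\{|t\rangle_A|\eta_j^{(t)}\rangle_B|\xi_k^{(t)}\rangle_C:(j,k)\in\mathbb{Z}_{B_t-1}\times\mathbb{Z}_{C_t-1}\setminus\{(0,0)\}\}$, $\mathcal{F}^{(t)}=\{|\beta_i^{(t)}\rangle_A|\beta_j^{(t)}\rangle_B|\beta_k^{(t)}\rangle_C:(i,j,k)\in\mathbb{Z}_{A_t-2}\times\mathbb{Z}_{B_t-2}\times\mathbb{Z}_{C_t-2}\setminus\{(0,0,0)\}\}$,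 and $|S\rangle=(\sum_{i=0}^{d_A-1}|i\rangle)_A(\sum_{j=0}^{d_B-1}|j\rangle)_B(\sum_{k=0}^{d_C-1}|k\rangle)_C$. States are unnormalized. An unextendible product basis (UPB) is a set of mutually orthogonal product states, not spanning the whole space, whose orthogonal complement contains no product state. A local measurement (POVM) on a set of mutually orthogonal states is orthogonality-preserving if the post-measurement states remain mutually orthogonal; a set of orthogonal states is locally irreducible if it is not possible to eliminate one or more states from the set by orthogonality-preserving local measurements; a tripartite orthogonal product set is strongly nonlocal if it is locally irreducible in every bipartition $A|BC$, $B|CA$, $C|AB$. *)

(* Defs.v *)
From HB Require Import structures.
From mathcomp Require Import all_boot all_order all_algebra.
From mathcomp Require Import all_classical all_reals.
From mathcomp Require Import trigo.
From mathcomp Require Import complex.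

Set Implicit Arguments.
Unset Strict Implicit.
Unset Printing Implicit Defensive.

Import Order.TTheory GRing.Theory Num.Theory.
Local Open Scope ring_scope.

Section QuantumDefs.
Variable R : realType.
Local Notation C := (R[i]).

Definition cvec (T : finType) := {ffun T -> C}.

Definition dotp (T : finType) (u v : cvec T) : C :=
  \sum_(x : T) conjc (u x) * v x.

Definition op (T : finType) := {ffun T * T -> C}.

(* a family of Kraus operators (M_k)_{k<K} of a measurement (POVM
   elements E_k = M_k^dagger M_k) with sum_k M_k^dagger M_k = Id *)
Definition kraus_complete (T : finType) (K : nat) (M : 'I_K -> op T) : Prop :=
  forall x x' : T,
    \sum_(k < K) \sum_(z : T) conjc (M k (z, x)) * M k (z, x') = (x == x')%:R.

Definition apply_left (X Y : finType) (M : op X) (psi : cvec (X * Y)%type) :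
  cvec (X * Y)%type := [ffun p => \sum_(x' : X) M (p.1, x') * psi (x', p.2)].
Definition apply_right (X Y : finType) (N : op Y) (psi : cvec (X * Y)%type) :
  cvec (X * Y)%type := [ffun p => \sum_(y' : Y) N (p.2, y') * psi (p.1, y')].

Definition preserves_orth (T : finType) (S : seq (cvec T))
  (f : cvec T -> cvec T) : Prop :=
  forall i j, (i < size S)%N -> (j < size S)%N -> i != j ->
    dotp (f (nth 0 S i)) (f (nth 0 S j)) = 0.

Definition local_OP_step (X Y : finType) (S S' : seq (cvec (X * Y)%type)) : Prop :=
  (exists (K : nat) (M : 'I_K -> op X) (k : 'I_K),
      kraus_complete M /\
      (forall k' : 'I_K, preserves_orth S (apply_left (M k'))) /\
      S' = map (apply_left (M k)) S)
  \/
  (exists (K : nat) (N : 'I_K -> op Y) (k : 'I_K),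
      kraus_complete N /\
      (forall k' : 'I_K, preserves_orth S (apply_right (N k'))) /\
      S' = map (apply_right (N k)) S).

Inductive OP_reachable (X Y : finType) :
    seq (cvec (X * Y)%type) -> seq (cvec (X * Y)%type) -> Prop :=
| OPr_refl S : OP_reachable S S
| OPr_step S S' S'' : local_OP_step S S' -> OP_reachable S' S'' ->
    OP_reachable S S''.

(* local irreducibility (bipartite X|Y): no sequence of orthogonality-preserving
   local measurements eliminates one or more states (post-measurement state 0)
   while leaving some state (i.e. with an outcome that can occur) *)
Definition locally_irreducible (X Y : finType) (S : seq (cvec (X * Y)%type)) : Prop :=
  ~ exists S' : seq (cvec (X * Y)%type),
      OP_reachable S S' /\
      (exists i, (i < size S')%N /\ nth 0 S' i = 0) /\
      (exists j, (j < size S')%N /\ nth 0 S' j != 0).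

Definition T3 (dA dB dC : nat) : finType := ('I_dA * 'I_dB * 'I_dC)%type.

Definition tens3 (dA dB dC : nat) (a : cvec 'I_dA) (b : cvec 'I_dB)
  (c : cvec 'I_dC) : cvec (T3 dA dB dC) :=
  [ffun p => a p.1.1 * b p.1.2 * c p.2].

Definition is_product_state (dA dB dC : nat) (v : cvec (T3 dA dB dC)) : Prop :=
  exists (a : cvec 'I_dA) (b : cvec 'I_dB) (c : cvec 'I_dC),
    [/\ a != 0, b != 0, c != 0 & v = tens3 a b c].

Definition is_UPB (dA dB dC : nat) (S : seq (cvec (T3 dA dB dC))) : Prop :=
  [/\ (forall v, v \in S -> is_product_state v),
      (forall u v, u \in S -> v \in S -> u != v -> dotp u v = 0),
      ~ (forall v : cvec (T3 dA dB dC), exists coef : 'I_(size S) -> C,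
            v = \sum_(i < size S) coef i *: nth 0 S i)
    & (forall (a : cvec 'I_dA) (b : cvec 'I_dB) (c : cvec 'I_dC),
         a != 0 -> b != 0 -> c != 0 ->
         ~ (forall u, u \in S -> dotp u (tens3 a b c) = 0))].

Definition bip_A (dA dB dC : nat) (v : cvec (T3 dA dB dC)) :
  cvec (prod 'I_dA (prod 'I_dB 'I_dC)) := [ffun p => v ((p.1, p.2.1), p.2.2)].
Definition bip_B (dA dB dC : nat) (v : cvec (T3 dA dB dC)) :
  cvec (prod 'I_dB (prod 'I_dC 'I_dA)) := [ffun p => v ((p.2.2, p.1), p.2.1)].
Definition bip_C (dA dB dC : nat) (v : cvec (T3 dA dB dC)) :
  cvec (prod 'I_dC (prod 'I_dA 'I_dB)) := [ffun p => v (p.2, p.1)].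

Definition strongly_nonlocal (dA dB dC : nat) (S : seq (cvec (T3 dA dB dC))) : Prop :=
  [/\ locally_irreducible (map (@bip_A dA dB dC) (undup S)),
      locally_irreducible (map (@bip_B dA dB dC) (undup S))
    & locally_irreducible (map (@bip_C dA dB dC) (undup S))].

Definition omega (m : nat) : C :=
  Complex (cos (2 * pi / m%:R)) (sin (2 * pi / m%:R)).

Definition ket (d r : nat) : cvec 'I_d := [ffun x : 'I_d => ((x : nat) == r)%:R].

Definition ones (d : nat) : cvec 'I_d := [ffun => 1].

Definition eta (d t s : nat) : cvec 'I_d :=
  \sum_(t <= r < d - t - 1) (omega (d - 2 * t - 1)) ^+ (s * (r - t)) *: ket d r.
Definition xi (d t s : nat) : cvec 'I_d :=
  \sum_(t <= r < d - t - 1) (omega (d - 2 * t - 1)) ^+ (s * (r - t)) *: ket d r.+1.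
Definition beta (d t s : nat) : cvec 'I_d :=
  \sum_(t <= r < d - t - 2) (omega (d - 2 * t - 2)) ^+ (s * (r - t)) *: ket d r.+1.

Definition pairs (p q : nat) : seq (nat * nat) :=
  [seq x <- [seq (i, j) | i <- iota 0 p, j <- iota 0 q] | x != (0, 0)%N].
Definition triples (p q r : nat) : seq (nat * nat * nat) :=
  [seq x <- [seq (i, jk.1, jk.2) | i <- iota 0 p,
                   jk <- [seq (j, k) | j <- iota 0 q, k <- iota 0 r]]
     | x != (0, 0, 0)%N].

Section Sets.
Variables dA dB dC : nat.
Local Notation tens := (@tens3 dA dB dC).

Definition setA1 t := [seq tens (xi dA t x.1) (ket dB t) (eta dC t x.2)
                        | x <- pairs (dA - 2 * t - 1) (dC - 2 * t - 1)].
Definition setA2 t := [seq tens (xi dA t x.1) (eta dB t x.2) (ket dC (dC - 1 - t))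
                        | x <- pairs (dA - 2 * t - 1) (dB - 2 * t - 1)].
Definition setA3 t := [seq tens (ket dA (dA - 1 - t)) (xi dB t x.1) (eta dC t x.2)
                        | x <- pairs (dB - 2 * t - 1) (dC - 2 * t - 1)].
Definition setB1 t := [seq tens (eta dA t x.1) (ket dB (dB - 1 - t)) (xi dC t x.2)
                        | x <- pairs (dA - 2 * t - 1) (dC - 2 * t - 1)].
Definition setB2 t := [seq tens (eta dA t x.1) (xi dB t x.2) (ket dC t)
                        | x <- pairs (dA - 2 * t - 1) (dB - 2 * t - 1)].
Definition setB3 t := [seq tens (ket dA t) (eta dB t x.1) (xi dC t x.2)
                        | x <- pairs (dB - 2 * t - 1) (dC - 2 * t - 1)].
Definition setF t := [seq tens (beta dA t x.1.1) (beta dB t x.1.2) (beta dC t x.2)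
                        | x <- triples (dA - 2 * t - 2) (dB - 2 * t - 2) (dC - 2 * t - 2)].
Definition stopper := tens (ones dA) (ones dB) (ones dC).

Definition U_set (n : nat) : seq (cvec (T3 dA dB dC)) :=
  flatten [seq setA1 t ++ setA2 t ++ setA3 t ++ setB1 t ++ setB2 t ++ setB3 t
          | t <- iota 0 n.+1]
  ++ setF n ++ [:: stopper].
End Sets.

End QuantumDefs.

(* Main.v *)
Require Import Defs.
From HB Require Import structures.
From mathcomp Require Import all_boot all_order all_algebra.
From mathcomp Require Import all_classical all_reals.
From mathcomp Require Import trigo complex.
From mathcomp Require Import zify ring lra.

(** Every state is a product of Fourier characters of intervals, so [U_n] consists
    of one orthogonal basis per tile, each without its all-ones vector, together
    with the stopper.

    Unextendibility: a product vector [a b c] orthogonal to a tile is constant on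
    it.  Going inwards layer by layer, either the pinwheel arrangement of the six
    tiles forces each factor to take a single nonzero value, or the factors vanish
    at the end points of the layer; in the core they are constant again.  Hence each
    factor has a nonzero sum, contradicting orthogonality to the stopper.

    Strong nonlocality: the outermost layer and the stopper already suffice.  Let
    [E = N^* N] act on two parties.  The tiles of layer 0 project onto the two-party
    grid as four sides, which partition its border, and two plates.  Orthogonality
    makes [E] vanish between a side and everything outside it.  Restricted to a
    plate, [E] maps a nontrivial character to a multiple of itself plus a constant;
    comparing with the side contained in the plate removes the constant, and the
    stopper equalizes the remaining eigenvalues, so [E] is scalar.  Therefore each
    orthogonality-preserving outcome is zero or a multiple of an isometry, and this
    persists along any sequence of measurements. *)

Set Implicit Arguments.
Unset Strict Implicit.
Unset Printing Implicit Defensive.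

Import Order.TTheory GRing.Theory Num.Theory.
Local Open Scope ring_scope.

(** Orthogonality of two post-measurement states only says $\langle a|a'\rangle\langle
    f|E|g\rangle=0$, so it constrains $E$ only when the factors of the idle party overlap. This
    dictates the choice of test states. Over a side, the idle party carries an interval of at least
    two points; giving it index 1 makes the label nonzero whatever the other two indices are, so a
    side is tested with a complete basis although its tile lacks the all-ones vector. Over a plate,
    the idle party sits on a single point, the all-ones vector is really missing, and every
    conclusion holds only up to an additive constant. Most of the work is the removal of these
    constants.

    The constants are read off where entries are known to vanish, namely across the boundary of a
    side. The block of the side inside the plate has no such entries, and this is where the column
    sums provided by the stopper are used. Each plate is treated together with one corner of the
    grid outside it, on the side that runs along its edge; the two enlarged plates then cover the
    grid and overlap, which leaves a single scalar. *)

(** * Interval characters *)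

Section RootsOfUnity.
Variable R : realType.
Local Notation C := (R[i]).

Lemma omega_exp m k : omega R m ^+ k =
  Complex (cos (2 * pi * k%:R / m%:R)) (sin (2 * pi * k%:R / m%:R)).
Proof.
elim: k => [|k IH]; first by rewrite expr0 mulr0 mul0r cos0 sin0.
rewrite exprS IH /omega.
have -> : 2 * pi * k.+1%:R / m%:R = 2 * pi / m%:R + 2 * pi * k%:R / m%:R :> R.
  by rewrite -natr1; ring.
rewrite cosD sinD.
by simpc; congr Complex; ring.
Qed.

Lemma omega_unit m : omega R m * conjc (omega R m) = 1.
Proof.
apply/eqP; rewrite eq_complex /=; apply/andP; split; apply/eqP; last by ring.
by rewrite mulrN opprK -!expr2 cos2Dsin2.
Qed.

(** If the order [k] were a proper divisor of $m=qk$, the angle $2\pi/q$ would have cosine 1, hence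
    $\sin(\pi/q)=0$, which is impossible for $q>1$. *)
Lemma omega_prim m : (0 < m)%N -> m.-primitive_root (omega R m).
Proof.
move=> m0; have mR : (0 : R) < m%:R by rewrite ltr0n.
have Em : omega R m ^+ m = 1.
  by rewrite omega_exp mulfK ?gt_eqF // mulr_natl cos2pi sin2pi.
have [k kP /dvdnP [q mE]] := prim_order_exists m0 Em.
have [k0 Ek] := (prim_order_gt0 kP, prim_expr_order kP).
suff mk : m = k by rewrite {1}mk.
move: (m0); rewrite {1}mE muln_gt0 => /andP[q0 _].
move: q0; rewrite leq_eqVlt => /orP[/eqP q1|q1]; first by rewrite mE -q1 mul1n.
have /eqP := Ek; rewrite omega_exp => /eqP[].
have -> : 2 * pi * k%:R / m%:R = (pi / q%:R) *+ 2 :> R.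
  rewrite -mulr_natl mE natrM; field.
  by rewrite !pnatr_eq0 -!lt0n k0 (ltn_trans _ q1).
rewrite cos_mulr2n => c1 _.
have : 0 < sin (pi / q%:R : R).
  have qR : (1 : R) < q%:R by rewrite ltr1n.
  have q0 : (0 : R) < q%:R by apply: lt_trans qR.
  rewrite sin_gt0_pi // divr_gt0 ?pi_gt0 //= ltr_pdivrMr //.
  by rewrite ltr_pMr ?pi_gt0.
have := cos2Dsin2 (pi / q%:R : R); move: c1; rewrite -mulr_natr.
move=> c1 cs s0; have s2 : 0 < sin (pi / q%:R : R) ^+ 2 by rewrite exprn_gt0.
move: (cos _ ^+ 2) (sin _ ^+ 2) c1 cs s2 => c s c1 cs s2.
by move: s2; rewrite -[s](addKr c) cs (_ : c = 1) ?addNr ?ltxx //; lra.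
Qed.

Lemma conj_root_cancel m k : conjc (omega R m ^+ k) * omega R m ^+ k = 1.
Proof. by rewrite rmorphXn -exprMn mulrC omega_unit expr1n. Qed.

Lemma root_conj_cancel m k : omega R m ^+ k * conjc (omega R m ^+ k) = 1.
Proof. by rewrite mulrC conj_root_cancel. Qed.

Lemma sum_root m (z : C) : z ^+ m = 1 -> z != 1 -> \sum_(i < m) z ^+ i = 0.
Proof.
move=> zm z1; have /eqP := subrX1 z m; rewrite zm subrr eq_sym mulf_eq0.
by rewrite subr_eq0 (negPf z1) => /eqP.
Qed.

Lemma root_orth m s s' : (s < m)%N -> (s' < m)%N ->
  \sum_(r < m) conjc (omega R m ^+ (s * r)) * omega R m ^+ (s' * r)
  = m%:R * (s == s')%:R.
Proof.
move=> sm s'm; have m0 : (0 < m)%N by apply: leq_ltn_trans sm.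
have P := omega_prim m0.
set z := conjc (omega R m ^+ s) * omega R m ^+ s'.
have -> : \sum_(r < m) conjc (omega R m ^+ (s * r)) * omega R m ^+ (s' * r)
    = \sum_(r < m) z ^+ r.
  by apply: eq_bigr => r _; rewrite /z exprMn -rmorphXn !exprM.
have [e|ne] := eqVneq s s'.
  rewrite (eq_bigr (fun=> 1)) ?sumr_const ?card_ord ?mulr1 // => i _.
  by rewrite /z e conj_root_cancel expr1n.
rewrite mulr0 sum_root //.
  rewrite /z exprMn -rmorphXn -!exprM ![(_ * m)%N]mulnC !exprM.
  by rewrite (prim_expr_order P) !expr1n rmorph1 mulr1.
apply: contra ne => /eqP z1.
have : omega R m ^+ s' = omega R m ^+ s.
  by rewrite -[LHS]mul1r -(root_conj_cancel m s) -mulrA -/z z1 mulr1.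
by move/eqP; rewrite (eq_prim_root_expr P) !modn_small // eq_sym.
Qed.
End RootsOfUnity.

Section Interval.
Variable R : realType.
Local Notation C := (R[i]).

Definition segm d l m := [pred x : 'I_d | l <= x < l + m]%N.

Definition chi d l m s : cvec R 'I_d :=
  [ffun x : 'I_d => if (l <= x < l + m)%N then omega R m ^+ (s * (x - l)) else 0].

Lemma chiE d l m s (x : 'I_d) : x \in segm d l m ->
  chi d l m s x = omega R m ^+ (s * (x - l)).
Proof. by rewrite ffunE inE => ->. Qed.

Lemma chi_out d l m s (x : 'I_d) : x \notin segm d l m -> chi d l m s x = 0.
Proof. by rewrite ffunE inE => /negbTE ->. Qed.

Lemma chi0 d l m (x : 'I_d) : x \in segm d l m -> chi d l m 0 x = 1.
Proof. by move=> xI; rewrite chiE // mul0n expr0. Qed.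

Lemma chi_neq0 d l m s (x : 'I_d) : x \in segm d l m -> chi d l m s x != 0.
Proof.
move=> xI; rewrite chiE //; apply/eqP => e.
by have := conj_root_cancel R m (s * (x - l)); rewrite e mulr0 => /eqP;
   rewrite eq_sym oner_eq0.
Qed.

(** Consecutive values differ by the factor [omega ^+ s], which is not 1. This is the form in which
    nontrivial characters are used as nonconstant functions. *)
Lemma chi_inj d l m s (x y : 'I_d) : x \in segm d l m ->
  y \in segm d l m -> (0 < s < m)%N -> y = x.+1 :> nat ->
  chi d l m s x != chi d l m s y.
Proof.
move=> xI yI /andP[s0 sm] xy; rewrite !chiE //.
have P : m.-primitive_root (omega R m).
  by apply: omega_prim; apply: leq_ltn_trans sm.
have -> : (y - l = (x - l).+1)%N by move: xI; rewrite inE; lia.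
rewrite mulnS exprD; apply/eqP => e.
have : omega R m ^+ s == omega R m ^+ 0.
  rewrite expr0 -[X in X == _]mulr1 -(root_conj_cancel R m (s * (x - l))).
  by rewrite mulrA -e root_conj_cancel.
by rewrite (eq_prim_root_expr P) mod0n modn_small // eqn0Ngt s0.
Qed.

Lemma sum_segm d l m (F : nat -> C) : (l + m <= d)%N ->
  \sum_(x : 'I_d | x \in segm d l m) F (x - l)%N = \sum_(r < m) F r.
Proof.
move=> lmd; rewrite -(big_mkord xpredT F) -(big_mkord (fun x => l <= x < l + m)%N
   (fun x => F (x - l)%N)).
rewrite (@big_cat_nat _ _ _ (l + m)) //= [X in _ + X]big_nat_cond.
rewrite [X in _ + X]big1 ?addr0; last by move=> i; lia.
rewrite (@big_cat_nat _ _ _ l) //= ?leq_addr // [X in X + _]big_nat_cond.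
rewrite [X in X + _]big1 ?add0r; last by move=> i; lia.
rewrite -{1}[l]add0n big_addn addKn [LHS]big_nat_cond [RHS]big_nat_cond.
by apply: eq_big => [i|i _]; [lia | rewrite addnK].
Qed.

Lemma sum_const_segm d l m (c : C) : (l + m <= d)%N ->
  \sum_(x : 'I_d | x \in segm d l m) c = m%:R * c.
Proof.
by move=> lmd; rewrite (sum_segm (fun=> c) lmd) sumr_const card_ord mulr_natl.
Qed.

Lemma dotp_chi d l m s s' : (l + m <= d)%N -> (s < m)%N -> (s' < m)%N ->
  dotp (chi d l m s) (chi d l m s') = m%:R * (s == s')%:R.
Proof.
move=> lmd sm s'm; rewrite -root_orth //.
rewrite -(sum_segm
  (fun r => conjc (omega R m ^+ (s * r)) * omega R m ^+ (s' * r)) lmd).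
rewrite /dotp [LHS](bigID (mem (segm d l m))) /= [X in _ + X]big1 ?addr0.
  by apply: eq_bigr => x xI; rewrite !chiE.
by move=> x xI; rewrite chi_out // rmorph0 mul0r.
Qed.

(** The character table is symmetric in label and offset, so completeness is [root_orth] with their
    roles exchanged. *)
Lemma chi_dual d l m (x y : 'I_d) : x \in segm d l m ->
  \sum_(s < m) chi d l m s x * conjc (chi d l m s y) = m%:R * (x == y)%:R.
Proof.
move=> xI; have [yI|yI] := boolP (y \in segm d l m); last first.
  rewrite big1 => [|s _]; last by rewrite (chi_out _ yI) rmorph0 mulr0.
  by case: eqVneq yI => [<-|]; rewrite ?xI ?mulr0.
have -> : (x == y) = (y - l == x - l)%N.
  by apply/eqP/eqP => [->//|e]; apply/val_inj; move: xI yI e; rewrite !inE /=; lia.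
move: (xI) (yI); rewrite !inE => xI' yI'.
rewrite -root_orth ?ltn_subLR //; try lia.
by apply: eq_bigr => s _; rewrite !chiE // mulrC ![(s * _)%N]mulnC.
Qed.
End Interval.

(** * Tight frames *)

Lemma sum_prod (V : nmodType) (X Y : finType) (F : X * Y -> V) :
  \sum_p F p = \sum_x \sum_y F (x, y).
Proof.
by rewrite (pair_bigA _ (fun x y => F (x, y))); apply: eq_bigr => -[].
Qed.

Lemma sum_delta (A : pzSemiRingType) (X : finType) (x : X) (F : X -> A) :
  \sum_y F y * (x == y)%:R = F x.
Proof.
rewrite (bigD1 x) //= eqxx mulr1 big1 ?addr0 // => y /negbTE.
by rewrite eq_sym => ->; rewrite mulr0.
Qed.

Section InnerProduct.
Variable R : realType.
Local Notation C := (R[i]).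

Definition tens2 (X Y : finType) (u : cvec R X) (v : cvec R Y) :
  cvec R (X * Y)%type := [ffun p => u p.1 * v p.2].

Lemma tens2E (X Y : finType) (u : cvec R X) (v : cvec R Y) p :
  tens2 u v p = u p.1 * v p.2.
Proof. exact: ffunE. Qed.

Lemma dotp_tens2 (X Y : finType) (u u' : cvec R X) (v v' : cvec R Y) :
  dotp (tens2 u v) (tens2 u' v') = dotp u u' * dotp v v'.
Proof.
rewrite /dotp sum_prod mulr_suml; apply: eq_bigr => x _.
rewrite mulr_sumr; apply: eq_bigr => y _.
by rewrite !ffunE /= rmorphM; ring.
Qed.

Lemma dotp_conj (X : finType) (u v : cvec R X) : dotp u v = conjc (dotp v u).
Proof.
rewrite /dotp rmorph_sum; apply: eq_bigr => x _.
by rewrite rmorphM /= conjcK mulrC.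
Qed.

Lemma dotpp_eq0 (X : finType) (u : cvec R X) : dotp u u = 0 -> u = 0.
Proof.
have -> : dotp u u = \sum_x `|u x| ^+ 2.
  by apply: eq_bigr => x _; rewrite sqr_normc mulrC.
move=> /eqP; rewrite psumr_eq0 => [/allP u0|x _]; last by rewrite exprn_ge0.
apply/ffunP => x; apply/eqP; rewrite ffunE -normr_eq0 -sqrf_eq0.
by apply: (implyP (u0 x _)); rewrite ?mem_index_enum.
Qed.

Lemma dotp0 (X : finType) (u : cvec R X) : dotp u 0 = 0.
Proof. by apply: big1 => x _; rewrite ffunE mulr0. Qed.

Lemma dotp_disjoint (X : finType) (u v : cvec R X) :
  (forall x, (u x == 0) || (v x == 0)) -> dotp u v = 0.
Proof.
move=> uv; apply: big1 => x _.
by case/orP: (uv x) => /eqP ->; rewrite ?rmorph0 ?mul0r ?mulr0.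
Qed.

End InnerProduct.

Section TightFrames.
Variable R : realType.
Local Notation C := (R[i]).

(** Completeness rather than orthogonality is recorded, because the arguments expand functions on
    [P]. Leaving [y] unrestricted lets the coefficients be sums over all of [X]. *)
Definition tight (L X : finType) (P : pred X) (N : C) (phi : L -> cvec R X) :=
  forall x y, x \in P ->
    \sum_s phi s x * conjc (phi s y) = N * (x == y)%:R.

Lemma tight_chi d l m :
  tight (segm d l m) m%:R (fun s : 'I_m => chi R d l m s).
Proof. by move=> x y xI; rewrite chi_dual. Qed.

Variables (L X : finType) (P : pred X) (N : C) (phi : L -> cvec R X).
Hypotheses (N0 : N != 0) (tP : tight P N phi).

Lemma tight_inversion (F : X -> C) x : x \in P ->
  N * F x = \sum_s phi s x * (\sum_y conjc (phi s y) * F y).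
Proof.
move=> xP; have <- := sum_delta x (fun y => N * F y).
under [RHS]eq_bigr do rewrite mulr_sumr.
rewrite exchange_big; apply: eq_bigr => y _ /=.
under eq_bigr do rewrite mulrA.
by rewrite -mulr_suml tP //; ring.
Qed.

(** The conjugate of [tight_inversion]; [N] is real, being a sum of squared moduli. It serves the
    linear second argument of a form, as [tight_inversion] serves the conjugated first one. *)
Lemma tight_inversion_conj (F : X -> C) x : x \in P ->
  N * F x = \sum_s conjc (phi s x) * (\sum_y phi s y * F y).
Proof.
move=> xP; have NR : conjc N = N.
  have := tP x xP; rewrite eqxx mulr1 => <-; rewrite rmorph_sum.
  by apply: eq_bigr => s _; rewrite rmorphM /= conjcK mulrC.
apply: (can_inj (@conjcK R)); rewrite rmorphM /= NR.
rewrite (tight_inversion (fun x => conjc (F x)) xP) rmorph_sum.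
apply: eq_bigr => s _; rewrite rmorphM /= conjcK rmorph_sum; congr (_ * _).
by apply: eq_bigr => y _; rewrite rmorphM.
Qed.

Lemma tight_zero (F : X -> C) x : x \in P ->
  (forall s, \sum_y conjc (phi s y) * F y = 0) -> F x = 0.
Proof.
move=> xP F0; apply: (mulfI N0); rewrite mulr0 (tight_inversion F xP).
by rewrite big1 // => s _; rewrite F0 mulr0.
Qed.

Lemma tight_zero_conj (F : X -> C) x : x \in P ->
  (forall s, \sum_y phi s y * F y = 0) -> F x = 0.
Proof.
move=> xP F0; apply: (mulfI N0); rewrite mulr0 (tight_inversion_conj F xP).
by rewrite big1 // => s _; rewrite F0 mulr0.
Qed.

Lemma tight_const s0 (F : X -> C) x y : {in P, forall z, phi s0 z = 1} ->
  (forall s, s != s0 -> \sum_y conjc (phi s y) * F y = 0) ->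
  x \in P -> y \in P -> F x = F y.
Proof.
move=> p1 F0 xP yP; apply: (mulfI N0).
suff H z : z \in P -> N * F z = \sum_w conjc (phi s0 w) * F w by rewrite !H.
move=> zP; rewrite (tight_inversion F zP) (bigD1 s0) //= [X in _ + X]big1.
  by rewrite p1 ?rmorph1 ?addr0 ?mul1r.
by move=> s ss0; rewrite F0 ?mulr0.
Qed.

Lemma tight_const_conj s0 (F : X -> C) x y : {in P, forall z, phi s0 z = 1} ->
  (forall s, s != s0 -> \sum_y phi s y * F y = 0) ->
  x \in P -> y \in P -> F x = F y.
Proof.
move=> p1 F0 xP yP; apply: (mulfI N0).
suff H z : z \in P -> N * F z = \sum_w phi s0 w * F w by rewrite !H.
move=> zP; rewrite (tight_inversion_conj F zP) (bigD1 s0) //= [X in _ + X]big1.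
  by rewrite p1 ?rmorph1 ?addr0 ?mul1r.
by move=> s ss0; rewrite F0 ?mulr0.
Qed.

Lemma tight_one s1 (F : X -> C) :
  (forall s, s != s1 -> \sum_y conjc (phi s y) * F y = 0) ->
  exists mu, {in P, forall x, F x = mu * phi s1 x}.
Proof.
move=> F0; exists (N^-1 * \sum_y conjc (phi s1 y) * F y) => x xP.
apply: (mulfI N0); rewrite (tight_inversion F xP) (bigD1 s1) //= [X in _ + X]big1.
  by rewrite addr0 -mulrA mulVKf // mulrC.
by move=> s ss1; rewrite F0 // mulr0.
Qed.

(** Applied with [s0] the label missing from a plate: the coefficient along it cannot be tested and
    survives as [gamma]. *)
Lemma tight_two s0 s1 (F : X -> C) : {in P, forall z, phi s0 z = 1} ->
  s1 != s0 ->
  (forall s, s != s0 -> s != s1 -> \sum_y conjc (phi s y) * F y = 0) ->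
  exists mu gamma, {in P, forall x, F x = mu * phi s1 x + gamma}.
Proof.
move=> p1 s10 F0; pose f s := \sum_y conjc (phi s y) * F y.
exists (N^-1 * f s1), (N^-1 * f s0) => x xP.
apply: (mulfI N0); rewrite (tight_inversion F xP) (bigD1 s1) //=.
rewrite (bigD1 s0) 1?eq_sym //= [X in _ + (_ + X)]big1.
  by rewrite addr0 p1 // mul1r mulrDr -mulrA !mulVKf // mulrC.
by move=> s /andP[ss1 ss0]; rewrite F0 // mulr0.
Qed.
End TightFrames.

Lemma tight_tens (R : realType) (L L' X Y : finType) (P : pred X) (P' : pred Y)
    N N' (phi : L -> cvec R X) (psi : L' -> cvec R Y) :
  tight P N phi -> tight P' N' psi ->
  tight [pred p | (p.1 \in P) && (p.2 \in P')] (N * N')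
    (fun s : L * L' => tens2 (phi s.1) (psi s.2)).
Proof.
move=> tP tP' [x y] [x' y'] /andP[/= xP yP].
have -> : ((x, y) == (x', y'))%:R = (x == x')%:R * (y == y')%:R :> R[i].
  by rewrite xpair_eqE; case: (x == x'); case: (y == y'); rewrite /= ?mul1r ?mul0r.
transitivity ((\sum_s phi s x * conjc (phi s x')) *
  (\sum_s psi s y * conjc (psi s y'))); last by rewrite tP // tP' //; ring.
rewrite sum_prod mulr_suml; apply: eq_bigr => s _.
rewrite mulr_sumr; apply: eq_bigr => s' _ /=.
by rewrite !ffunE /= rmorphM; ring.
Qed.

(** * The plate argument *)

Section Form.
Variable R : realType.
Local Notation C := (R[i]).

(** For [E] the Gram matrix of a measurement operator this is the inner product of the two
    post-measurement vectors, see [dotp_act]. *)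
Definition sform (X : finType) (E : X -> X -> C) (f g : cvec R X) : C :=
  \sum_x conjc (f x) * (\sum_y E x y * g y).

Lemma sum_ket d (z : 'I_d) (F : 'I_d -> C) : \sum_x F x * ket R d z x = F z.
Proof.
rewrite -[RHS](sum_delta z F); apply: eq_bigr => x _.
by rewrite ffunE eq_sym.
Qed.

Lemma sform_tens_ket d (X : finType) E (f g : cvec R X) (z z' : 'I_d) :
  sform E (tens2 f (ket R d z)) (tens2 g (ket R d z')) =
  \sum_x conjc (f x) * (\sum_y E (x, z) (y, z') * g y).
Proof.
rewrite /sform sum_prod; apply: eq_bigr => x _.
transitivity (\sum_w (conjc (f x) * (\sum_y E (x, w) y * tens2 g (ket R d z') y))
   * ket R d z w).
  by apply: eq_bigr => w _; rewrite !ffunE rmorphM rmorph_nat /=; ring.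
rewrite sum_ket sum_prod; congr (_ * _); apply: eq_bigr => y _.
rewrite -[RHS](sum_ket z' (fun w => E (x, z) (y, w) * g y)).
by apply: eq_bigr => w _; rewrite !ffunE mulrA.
Qed.

Lemma sform_ket_tens d (X : finType) E (f g : cvec R X) (z z' : 'I_d) :
  sform E (tens2 (ket R d z) f) (tens2 (ket R d z') g) =
  \sum_x conjc (f x) * (\sum_y E (z, x) (z', y) * g y).
Proof.
rewrite /sform sum_prod exchange_big; apply: eq_bigr => x _ /=.
transitivity (\sum_w (conjc (f x) * (\sum_y E (w, x) y * tens2 (ket R d z') g y))
   * ket R d z w).
  by apply: eq_bigr => w _; rewrite !ffunE rmorphM rmorph_nat /=; ring.
rewrite sum_ket sum_prod exchange_big; congr (_ * _); apply: eq_bigr => y _ /=.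
rewrite -[RHS](sum_ket z' (fun w => E (z, x) (w, y) * g y)).
by apply: eq_bigr => w _; rewrite !ffunE /=; ring.
Qed.
End Form.

Lemma consecutive_in_segm d l m : (l + m <= d)%N -> (2 <= m)%N ->
  exists x y : 'I_d, [/\ x \in segm d l m, y \in segm d l m & y = x.+1 :> nat].
Proof.
move=> lmd m2; have a : (l < d)%N by lia.
have b : (l.+1 < d)%N by lia.
by exists (Ordinal a), (Ordinal b); split; rewrite ?inE //=; lia.
Qed.

Lemma other_in_segm d l m (y : 'I_d) : (l + m <= d)%N -> (2 <= m)%N ->
  exists2 x, x \in segm d l m & x != y.
Proof.
move=> lmd m2; have [a [b [aI bI ab]]] := consecutive_in_segm lmd m2.
have [<-|ay] := eqVneq a y; last by exists a.
by exists b => //; rewrite -val_eqE /= ab gtn_eqF.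
Qed.

(** * Scalarity on one plate and its adjacent corner *)

Section Core.
Variable R : realType.
Local Notation C := (R[i]).
Variables (dY dZ lY mY lZ mZ lJ : nat) (y0 : 'I_dY) (z0 z1 : 'I_dZ).
Variable E : 'I_dY * 'I_dZ -> 'I_dY * 'I_dZ -> C.

Local Notation IY := (segm dY lY mY).
Local Notation IZ := (segm dZ lZ mZ).
Local Notation B j := (chi R dY lY mY j).
Local Notation K k := (chi R dZ lZ mZ k).
Local Notation J k := (chi R dZ lJ mZ k).
(** [box] is the plate, which misses the line [z1]. [full_side] is the side contained in it;
    [short_side] runs along its edge [y0] and leaves it at exactly one point, the corner
    [(y0, z1)]. *)
Local Notation box := [pred p : 'I_dY * 'I_dZ | (p.1 \in IY) && (p.2 \in IZ)].
Local Notation full_side := [pred p : 'I_dY * 'I_dZ | (p.1 \in IY) && (p.2 == z0)].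
Local Notation short_side := [pred p : 'I_dY * 'I_dZ | (p.1 == y0) && (p.2 != z0)].

Hypothesis lmY : (lY + mY <= dY)%N.
Hypothesis lmJ : (lJ + mZ <= dZ)%N.
Hypotheses (mY2 : (2 <= mY)%N) (mZ2 : (2 <= mZ)%N).
Hypotheses (y0I : y0 \in IY) (z10 : z1 != z0).
Variable za : 'I_dZ.
Hypotheses (zaI : za \in IZ) (zaz0 : za != z0).
Hypothesis IZE : forall z, (z \in IZ) = (z != z1).
Hypothesis JE : forall z, (z \in segm dZ lJ mZ) = (z != z0).

Hypothesis herm : forall x y, E y x = conjc (E x y).
Hypothesis full_out : forall x y, x \in full_side -> y \notin full_side -> E x y = 0.
Hypothesis short_out : forall x y, x \in short_side -> y \notin short_side -> E x y = 0.
Hypothesis box_out : forall x y, x \notin box -> x != (y0, z1) -> y \in box -> E x y = 0.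
Hypothesis full_orth : forall j j', (j < mY)%N -> (j' < mY)%N -> j != j' ->
  sform E (tens2 (B j) (ket R dZ z0)) (tens2 (B j') (ket R dZ z0)) = 0.
Hypothesis short_orth :
  sform E (tens2 (ket R dY y0) (J 0)) (tens2 (ket R dY y0) (J 1)) = 0.
Hypothesis box_orth : forall j k j' k', (j < mY)%N -> (k < mZ)%N ->
  (j' < mY)%N -> (k' < mZ)%N -> (j, k) != (0, 0)%N -> (j', k') != (0, 0)%N ->
  (j, k) != (j', k') -> sform E (tens2 (B j) (K k)) (tens2 (B j') (K k')) = 0.
Hypothesis ones_orth : forall j k, (j < mY)%N -> (k < mZ)%N ->
  (j, k) != (0, 0)%N -> sform E [ffun=> 1] (tens2 (B j) (K k)) = 0.

Let mYn0 : mY%:R != 0 :> C. Proof. by rewrite pnatr_eq0; lia. Qed.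
Let mZn0 : mZ%:R != 0 :> C. Proof. by rewrite pnatr_eq0; lia. Qed.
Let mYZn0 : mY%:R * mZ%:R != 0 :> C. Proof. by rewrite mulf_neq0. Qed.
Let tY := @tight_chi R dY lY mY.
Let tZ := @tight_chi R dZ lZ mZ.
Let tYZ := tight_tens tY tZ.
Let mY0 : (0 < mY)%N. Proof. by lia. Qed.
Let mZ0 : (0 < mZ)%N. Proof. by lia. Qed.
Let o0 : 'I_mY * 'I_mZ := (Ordinal mY0, Ordinal mZ0).

Let z0I : z0 \in IZ. Proof. by rewrite IZE eq_sym. Qed.

Let out_full x y : x \notin full_side -> y \in full_side -> E x y = 0.
Proof. by move=> xF yF; rewrite herm full_out ?rmorph0. Qed.

Let out_short x y : x \notin short_side -> y \in short_side -> E x y = 0.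
Proof. by move=> xF yF; rewrite herm short_out ?rmorph0. Qed.

Let chi_box0 : {in box, forall p, tens2 (B 0) (K 0) p = 1}.
Proof. by move=> [y z] /andP[/= yI zI]; rewrite tens2E /= !chi0 ?mulr1. Qed.

(** On a side the constant character is available too, so no additive constant appears. *)
Lemma full_eigen j : (j < mY)%N -> exists mu, {in IY, forall y,
  \sum_y' E (y, z0) (y', z0) * B j y' = mu * B j y}.
Proof.
move=> jm; apply: (tight_one mYn0 tY (s1 := Ordinal jm)) => s sj.
by rewrite -sform_tens_ket full_orth.
Qed.

Lemma box_eigen j k : (j < mY)%N -> (k < mZ)%N -> (j, k) != (0, 0)%N ->
  exists alpha gamma, {in box, forall p,
    \sum_q E p q * tens2 (B j) (K k) q = alpha * tens2 (B j) (K k) p + gamma}.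
Proof.
move=> jm km jk0.
pose F p := \sum_q E p q * tens2 (B j) (K k) q.
apply: (tight_two mYZn0 tYZ (s0 := o0) (s1 := (Ordinal jm, Ordinal km)) (F := F)).
- exact: chi_box0.
- exact: jk0.
by move=> [s s'] ss0 ss1; apply: box_orth.
Qed.

Lemma full_side_eval j k y : y \in IY ->
  \sum_q E (y, z0) q * tens2 (B j) (K k) q =
  K k z0 * \sum_y' E (y, z0) (y', z0) * B j y'.
Proof.
move=> yI; rewrite sum_prod mulr_sumr; apply: eq_bigr => y' _.
rewrite (bigD1 z0) //= [X in _ + X]big1 => [|z zz0].
  by rewrite addr0 tens2E /=; ring.
by rewrite full_out ?mul0r // inE /= ?yI ?eqxx // (negPf zz0) andbF.
Qed.

(* On the full side the character varies only through [B j], which is not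
   constant for [0 < j]: comparing two of its points kills [gamma]. *)
Lemma box_eigen_pos j : (0 < j < mY)%N -> exists mu, forall k, (k < mZ)%N ->
  {in box, forall p,
    \sum_q E p q * tens2 (B j) (K k) q = mu * tens2 (B j) (K k) p}.
Proof.
move=> /andP[j0 jm]; have [mu muE] := full_eigen jm.
(* The eigenvalue read on the full side depends on [j] alone, so it serves every [k]. *)
exists mu => k km p pB.
have jk0 : (j, k) != (0, 0)%N by rewrite xpair_eqE; case: j j0 {jm muE}.
have [al [ga agE]] := box_eigen jm km jk0.
have [ya [yb [Ia Ib yab]]] := consecutive_in_segm lmY mY2.
have ev y : y \in IY -> (mu - al) * (K k z0 * B j y) = ga.
  move=> yI; have := agE (y, z0); rewrite inE /= yI z0I => /(_ isT).
  rewrite full_side_eval // muE // tens2E /= => e.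
  by apply: (addrI (al * (B j y * K k z0))); rewrite -e; ring.
have ma : mu = al.
  apply/eqP; rewrite -subr_eq0; apply/eqP/(mulIf (x := K k z0)).
    exact: chi_neq0.
  apply/(mulIf (x := B j yb - B j ya)).
    by rewrite subr_eq0 eq_sym; apply: chi_inj; rewrite // j0.
  rewrite !mul0r mulrBr -!mulrA ev // ev //.
  exact: subrr.
have g0 : ga = 0 by rewrite -(ev ya Ia) ma subrr mul0r.
by rewrite agE // ma g0 addr0.
Qed.

(** Since the eigenvalue does not depend on [k], Fourier inversion in the second coordinate
    separates the lines of constant [z]. *)
Lemma box_row j : (0 < j < mY)%N -> exists mu, forall y z z',
  y \in IY -> z \in IZ -> z' \in IZ ->
  \sum_y' E (y, z) (y', z') * B j y' = mu * B j y * (z == z')%:R.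
Proof.
move=> jm; have [mu muE] := box_eigen_pos jm; exists mu => y z z' yI zI z'I.
apply/eqP; rewrite -subr_eq0; apply/eqP.
pose F w := \sum_y' E (y, z) (y', w) * B j y' - mu * B j y * (z == w)%:R.
apply: (tight_zero_conj mZn0 tZ (F := F) z'I) => s.
under eq_bigr do rewrite mulrBr.
rewrite sumrB; apply/eqP; rewrite subr_eq0; apply/eqP.
transitivity (\sum_q E (y, z) q * tens2 (B j) (K s) q).
  rewrite sum_prod exchange_big; apply: eq_bigr => w _ /=.
  by rewrite mulr_sumr; apply: eq_bigr => x _; rewrite tens2E /=; ring.
rewrite muE ?tens2E //=; last by rewrite inE /= yI zI.
rewrite -[LHS](sum_delta z (fun w => mu * (B j y * K s w))).
by apply: eq_bigr => w _; ring.
Qed.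

(** The short side makes the eigenvalue independent of [j]: the row of [(y0, za)] meets the line
    [za] only in its diagonal entry, which therefore equals every eigenvalue. The deviation from
    [mu] is then killed by all nonconstant characters in [y'], which leaves the constant [g]. *)
Lemma box_entries : exists mu, forall y z z', y \in IY -> z \in IZ -> z' \in IZ ->
  exists g, {in IY, forall y',
    E (y, z) (y', z') = mu * ((y, z) == (y', z'))%:R + g}.
Proof.
pose mu := E (y0, za) (y0, za); exists mu => y z z' yI zI z'I.
have row j : (0 < j < mY)%N ->
    \sum_y' E (y, z) (y', z') * B j y' = mu * B j y * (z == z')%:R.
  move=> jm; have [nu nuE] := box_row jm; rewrite nuE //.
  suff -> : nu = mu by [].
  apply: (mulIf (chi_neq0 R j y0I)).
  have := nuE y0 za za y0I zaI zaI; rewrite eqxx mulr1 => <-.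
  rewrite (bigD1 y0) //= big1 ?addr0 // => x xy0.
  by rewrite short_out ?mul0r // inE /= ?eqxx // (negPf xy0).
pose G x := E (y, z) (x, z') - mu * ((y, z) == (x, z'))%:R.
exists (G y0) => x xI.
suff <- : G x = G y0 by rewrite /G; ring.
apply: (tight_const_conj mYn0 tY (s0 := Ordinal mY0) (F := G)) => //.
  by move=> w wI; rewrite chi0.
move=> s s0; under eq_bigr do rewrite /G mulrBr.
rewrite sumrB; apply/eqP; rewrite subr_eq0; apply/eqP.
transitivity (mu * B s y * (z == z')%:R).
  rewrite -row; last by rewrite ltn_ord lt0n s0.
  by apply: eq_bigr => w _; rewrite mulrC.
rewrite -(sum_delta y (fun w => mu * B s w * (z == z')%:R)).
apply: eq_bigr => w _; rewrite xpair_eqE.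
by case: (y == w); case: (z == z'); rewrite /=; ring.
Qed.

(** The contribution of the stopper: its orthogonality relations say that the column sums pair to
    zero with every nontrivial character of the plate. *)
Lemma column_sum p q : p \in box -> q \in box -> \sum_x E x p = \sum_x E x q.
Proof.
pose F p := \sum_x E x p.
apply: (tight_const_conj mYZn0 tYZ (s0 := o0) (F := F)); first exact: chi_box0.
move=> [s s'] ss; rewrite -[RHS](ones_orth (ltn_ord s) (ltn_ord s')) //.
rewrite /sform; under eq_bigr do rewrite mulr_sumr.
rewrite exchange_big; apply: eq_bigr => x _ /=.
by rewrite ffunE rmorph1 mul1r; apply: eq_bigr => y _; rewrite mulrC.
Qed.

Let in_box y z : ((y, z) \in box) = (y \in IY) && (z \in IZ). Proof. by []. Qed.
Let in_full y z : ((y, z) \in full_side) = (y \in IY) && (z == z0). Proof. by []. Qed.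
Let in_short y z : ((y, z) \in short_side) = (y == y0) && (z != z0). Proof. by []. Qed.
Let inB := (in_box, in_full, in_short).

Lemma core_scalar : exists mu, forall p q,
  (p \in box) || (p == (y0, z1)) -> (q \in box) || (q == (y0, z1)) ->
  E p q = mu * (p == q)%:R.
Proof.
have [mu muE] := box_entries; exists mu.
(* If exactly one point is on the full side the entry vanishes. Otherwise [g] is read at a pair of
   points of which exactly one is on the short side. *)
have off p q : p \in box -> q \in box -> (p.2 != z0) || (q.2 != z0) ->
    E p q = mu * (p == q)%:R.
  case: p q => [y z] [y' z'] /andP[/= yI zI] /andP[/= y'I z'I].
  have [zz|zz] := eqVneq z z0; rewrite ?orbF /=.
    move=> z'z; rewrite full_out ?inB ?yI ?zz ?eqxx ?(negPf z'z) ?andbF //.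
    by rewrite xpair_eqE [z0 == _]eq_sym (negPf z'z) andbF mulr0.
  move=> _; have [zz'|zz'] := eqVneq z' z0.
    rewrite out_full ?inB ?y'I ?zz' ?eqxx ?(negPf zz) ?andbF //.
    by rewrite xpair_eqE (negPf zz) andbF mulr0.
  have [g gE] := muE y z z' yI zI z'I.
  suff g0 : g = 0 by rewrite gE // g0 addr0.
  have [yy0|yy0] := eqVneq y y0.
    have [w wI wy] := other_in_segm y0 lmY mY2.
    have := gE w wI; rewrite short_out ?inB /= ?yy0 ?eqxx ?zz ?(negPf wy) //.
    by rewrite xpair_eqE eq_sym (negPf wy) mulr0 add0r => <-.
  have := gE y0 y0I; rewrite out_short ?inB /= ?eqxx ?zz' ?(negPf yy0) //.
  by rewrite xpair_eqE (negPf yy0) mulr0 add0r => <-.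
have [w wI wy0] := other_in_segm y0 lmY mY2.
(* The point [(w, za)] is on neither side, so its column has only the diagonal entry; this gives the
   common value of all column sums. *)
have csum q : q \in box -> \sum_x E x q = mu.
  move=> qB; rewrite (column_sum (q := (w, za)) qB) ?inB /= ?wI ?zaI //.
  rewrite -[RHS](sum_delta (w, za) (fun=> mu)); apply: eq_bigr => x _.
  have [xB|xB] := boolP (x \in box).
    by rewrite off ?inB /= ?wI ?zaI ?zaz0 ?orbT // eq_sym.
  rewrite [_ == x]eq_sym; have -> : (x == (w, za)) = false.
    by apply: contraNF xB => /eqP ->; rewrite inB /= wI zaI.
  rewrite mulr0; have [->|xn] := eqVneq x (y0, z1).
    by rewrite short_out ?inB /= ?eqxx ?z10 // (negPf wy0).
  by rewrite box_out ?inB /= ?wI ?zaI.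
have line y y' : y \in IY -> y' \in IY -> E (y, z0) (y', z0) = mu * (y == y')%:R.
  (* In the block of the full side the constant is the same for all rows, because the eigenvalue
     [nu] of the all-ones vector satisfies $\nu=\mu+m_Yh$. The column sum $\mu+m_Yh$ must then equal
     $\mu$. *)
  have [h hE] : exists h, {in IY &, forall y y',
      E (y, z0) (y', z0) = mu * (y == y')%:R + h}.
    have [nu nuE] := full_eigen mY0.
    exists ((nu - mu) / mY%:R) => x x' xI x'I.
    have [g gE] := muE x z0 z0 xI z0I z0I.
    suff -> : nu = mu + mY%:R * g.
      rewrite gE // xpair_eqE eqxx andbT [mu + mY%:R * g]addrC addrK.
      by rewrite mulrAC divff // mul1r.
    have := nuE x xI; rewrite chi0 // mulr1 => <-.
    rewrite (bigID (mem IY)) /= [X in _ + X]big1 ?addr0 => [|u uI]; last first.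
      by rewrite chi_out ?mulr0.
    rewrite (eq_bigr (fun u => mu * (x == u)%:R + g)) => [|u uI]; last first.
      by rewrite gE // chi0 // mulr1 xpair_eqE eqxx andbT.
    rewrite big_split /= sum_const_segm // (bigD1 x) //= big1 => [|u /andP[_ ux]].
      by rewrite eqxx mulr1 addr0.
    by rewrite eq_sym (negPf ux) mulr0.
  move=> yI y'I; rewrite hE //; suff -> : h = 0 by rewrite addr0.
  have := csum (y', z0); rewrite inB /= y'I z0I => /(_ isT).
  rewrite sum_prod (bigID (mem IY)) /= [X in _ + X]big1 => [|u uI]; last first.
    apply: big1 => z _; rewrite out_full ?inB /= ?(negPf uI) //.
    by rewrite y'I eqxx.
  rewrite addr0 (eq_bigr (fun u => mu * (u == y')%:R + h)) => [|u uI]; last first.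
    rewrite (bigD1 z0) //= hE // big1 ?addr0 // => z zz0.
    by rewrite out_full ?inB /= ?y'I ?eqxx // (negPf zz0) andbF.
  rewrite big_split /= sum_const_segm // (bigD1 y') //= big1 => [|u /andP[_ uy]].
    rewrite eqxx mulr1 addr0 => /(canRL (addKr _)).
    by rewrite addNr => /eqP; rewrite mulf_eq0 (negPf mYn0) => /eqP.
  by rewrite (negPf uy) mulr0.
have boxE p q : p \in box -> q \in box -> E p q = mu * (p == q)%:R.
  move=> pB qB; have [pq|] := boolP ((p.2 != z0) || (q.2 != z0)); first exact: off.
  rewrite negb_or !negbK => /andP[/eqP p2 /eqP q2].
  move: p q pB qB p2 q2 => [y z] [y' z'] /andP[/= yI _] /andP[/= y'I _] -> ->.
  by rewrite line // xpair_eqE eqxx andbT.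
have z1I : z1 \notin IZ by rewrite IZE eqxx.
(* For a point of the short side inside the plate, the diagonal entry already exhausts the column
   sum [mu], and the corner entry is the only other candidate. *)
have cornerE q : q \in box -> E (y0, z1) q = 0.
  case: q => y z qB; move: (qB) => /andP[/= yI zI].
  have [/andP[/= /eqP -> zz0]|nq] := boolP ((y, z) \in short_side); last first.
    by rewrite short_out ?inB /= ?eqxx.
  have qB' : (y0, z) \in box by rewrite inB /= y0I.
  have := csum _ qB'; rewrite (bigD1 (y0, z1)) //= (bigD1 (y0, z)) /=; last first.
    by rewrite xpair_eqE eqxx /=; apply: contraTneq zI => ->.
  rewrite (boxE (y0, z) _ qB' qB') eqxx mulr1 big1 => [|x /andP[x1 xz]].
    by rewrite addr0 addrC => /(canRL (addKr _)); rewrite addNr.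
  have [xB|xB] := boolP (x \in box); last by rewrite box_out.
  by rewrite boxE // (negPf xz) mulr0.
(* [J 0] and [J 1] are orthogonal on the short side, where [E] can differ from [mu] only at the
   corner; their form therefore isolates that difference. *)
have corner_diag : E (y0, z1) (y0, z1) = mu.
  have z1J : z1 \in segm dZ lJ mZ by rewrite JE.
  have mZ1 : (1 < mZ)%N := mZ2.
  have e0 : dotp (J 0) (J 1) = 0 by rewrite dotp_chi // mulr0.
  apply/eqP; rewrite -subr_eq0; apply/eqP/(mulIf (chi_neq0 R 1 z1J)).
  transitivity (sform E (tens2 (ket R dY y0) (J 0)) (tens2 (ket R dY y0) (J 1))
    - mu * dotp (J 0) (J 1)); last by rewrite short_orth e0 mulr0 subr0 mul0r.
  rewrite sform_ket_tens /dotp mulr_sumr -sumrB.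
  rewrite [RHS](bigD1 z1) //= [X in _ = _ + X]big1 => [|z zz1].
    rewrite addr0 chi0 // rmorph1 !mul1r (bigD1 z1) //= big1 => [|z zz1].
      by rewrite addr0 mulrBl.
    have [->|zz0] := eqVneq z z0; first by rewrite chi_out ?JE ?eqxx // mulr0.
    by rewrite cornerE ?mul0r // inE /= y0I IZE zz1.
  have [->|zz0] := eqVneq z z0.
    by rewrite chi_out ?JE ?eqxx // rmorph0 !mul0r mulr0 subrr.
  have zI : z \in IZ by rewrite IZE.
  have zB : (y0, z) \in box by rewrite inB /= y0I.
  rewrite (bigD1 z1) //= herm cornerE // rmorph0 mul0r add0r.
  rewrite (bigD1 z) //= (boxE _ _ zB zB) eqxx mulr1 big1 => [|u /andP[uz1 uz]].
    by rewrite addr0; ring.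
  have [->|uz0] := eqVneq u z0; first by rewrite chi_out ?JE ?eqxx // mulr0.
  rewrite boxE ?inB /= ?y0I ?IZE //.
  by rewrite xpair_eqE eqxx /= eq_sym (negPf uz) mulr0 mul0r.
move=> p q pB qB; have [->|pn] := eqVneq p (y0, z1); last first.
  have [qe|qn] := eqVneq q (y0, z1); last first.
    by rewrite boxE //; [move: pB | move: qB]; rewrite (negPf pn, negPf qn) orbF.
  rewrite qe (negPf pn) mulr0 herm cornerE ?rmorph0 //.
  by move: pB; rewrite (negPf pn) orbF.
have [->|qn] := eqVneq q (y0, z1); first by rewrite corner_diag mulr1.
rewrite mulr0 cornerE //.
by move: qB; rewrite (negPf qn) orbF.
Qed.
End Core.

(** * Tiles as products of intervals, and operator blocks between rectangles *)

Section TwoParty.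
Variable R : realType.
Local Notation C := (R[i]).

(** For each party, the first point and the length of an interval. *)
Definition tile : Type := ((nat * nat) * (nat * nat) * (nat * nat))%type.

(** Listed in the order [setA1], [setA2], [setA3], [setB1], [setB2], [setB3]. *)
Definition layer (dX dY dZ t : nat) : seq tile :=
  let mX := (dX - 2 * t - 1)%N in
  let mY := (dY - 2 * t - 1)%N in
  let mZ := (dZ - 2 * t - 1)%N in
  [:: ((t.+1, mX), (t, 1), (t, mZ));
      ((t.+1, mX), (t, mY), (dZ - 1 - t, 1));
      ((dX - 1 - t, 1), (t.+1, mY), (t, mZ));
      ((t, mX), (dY - 1 - t, 1), (t.+1, mZ));
      ((t, mX), (t.+1, mY), (t, 1));
      ((t, 1), (t, mY), (t.+1, mZ))]%N.

(** Thanks to this all three factors of every state are interval characters, and the six families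
    need no separate treatment. *)
Lemma ket_chi d r : ket R d r = chi R d r 1 0.
Proof.
apply/ffunP => x; rewrite !ffunE mul0n expr0 addn1 ltnS.
by rewrite -eqn_leq eq_sym; case: eqP.
Qed.

Lemma dotp_chi_disjoint d l m s l' m' s' :
  (l + m <= l')%N || (l' + m' <= l)%N ->
  dotp (chi R d l m s) (chi R d l' m' s') = 0.
Proof.
move=> ll; apply: dotp_disjoint => x; have [xI|xI] := boolP (x \in segm d l m).
  have xI' : x \notin segm d l' m' by move: xI ll; rewrite !inE; lia.
  by rewrite (chi_out R _ xI') eqxx orbT.
by rewrite chi_out ?eqxx.
Qed.

Lemma dotp_chi_ket d l m s r : (l <= r < l + m)%N -> (r < d)%N ->
  dotp (chi R d l m s) (chi R d r 1 0) != 0.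
Proof.
move=> lr rd; rewrite -ket_chi (_ : dotp _ _ = conjc (chi R d l m s (Ordinal rd))).
  by rewrite conjc_eq0 chi_neq0 // inE.
exact: (sum_ket (Ordinal rd) (fun x => conjc (chi R d l m s x))).
Qed.

(* Every term of the inner product is [omega], so none cancel. *)
Lemma dotp_chi_shift d : (3 <= d)%N ->
  dotp (chi R d 1 (d - 1) 1) (chi R d 0 (d - 1) 1) != 0.
Proof.
move=> d3; rewrite (_ : dotp _ _ = (d - 2)%:R * omega R (d - 1)).
  rewrite mulf_neq0 ?pnatr_eq0; [by [] | by lia |].
  apply/eqP => w0; have := omega_unit R (d - 1); rewrite w0 mul0r => /eqP.
  by rewrite eq_sym oner_eq0.
rewrite -(@sum_const_segm R d 1 (d - 2)); last by lia.
rewrite /dotp [LHS](bigID (mem (segm d 1 (d - 2)))) /= [X in _ + X]big1 => [|x xI].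
  rewrite addr0; apply: eq_bigr => x xI.
  have x1 : x \in segm d 1 (d - 1) by move: xI; rewrite !inE; lia.
  have x2 : x \in segm d 0 (d - 1) by move: xI; rewrite !inE; lia.
  rewrite !chiE // !mul1n subn0.
  have -> : nat_of_ord x = (x - 1).+1 by move: xI; rewrite inE; lia.
  by rewrite subSS subn0 exprSr mulrA conj_root_cancel mul1r.
have [x1|x1] := boolP (x \in segm d 1 (d - 1)).
  by rewrite [X in _ * X]chi_out ?mulr0 //; move: xI x1; rewrite !inE; lia.
by rewrite chi_out ?rmorph0 ?mul0r.
Qed.

Section Rectangles.
Variables (dY dZ : nat) (E : 'I_dY * 'I_dZ -> 'I_dY * 'I_dZ -> C).
Variables (lY mY lZ mZ lY' mY' lZ' mZ' : nat).
Hypothesis pos : [&& 0 < mY, 0 < mZ, 0 < mY' & 0 < mZ']%N.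
Local Notation T := [pred p : 'I_dY * 'I_dZ |
  (p.1 \in segm dY lY mY) && (p.2 \in segm dZ lZ mZ)].
Local Notation T' := [pred p : 'I_dY * 'I_dZ |
  (p.1 \in segm dY lY' mY') && (p.2 \in segm dZ lZ' mZ')].
Local Notation f j k := (tens2 (chi R dY lY mY j) (chi R dZ lZ mZ k)).
Local Notation g j k := (tens2 (chi R dY lY' mY' j) (chi R dZ lZ' mZ' k)).

Let n0 a b : (0 < a)%N -> (0 < b)%N -> a%:R * b%:R != 0 :> C.
Proof. by move=> a0 b0; rewrite mulf_neq0 // pnatr_eq0 -lt0n. Qed.

Lemma rect_coef j' k' p :
  (forall j k, (j < mY)%N -> (k < mZ)%N -> sform E (f j k) (g j' k') = 0) ->
  p \in T -> \sum_q g j' k' q * E p q = 0.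
Proof.
case/and4P: pos => a b _ _ H pT.
under eq_bigr do rewrite mulrC.
apply: (tight_zero (n0 a b) (tight_tens (@tight_chi R dY lY mY)
  (@tight_chi R dZ lZ mZ)) (F := fun p => \sum_q E p q * g j' k' q) pT) => -[s s'].
exact: H.
Qed.

Lemma rect_zero p q :
  (forall j k j' k', (j < mY)%N -> (k < mZ)%N -> (j' < mY')%N -> (k' < mZ')%N ->
    sform E (f j k) (g j' k') = 0) ->
  p \in T -> q \in T' -> E p q = 0.
Proof.
case/and4P: (pos) => _ _ a b H pT qT.
apply: (tight_zero_conj (n0 a b) (tight_tens (@tight_chi R dY lY' mY')
  (@tight_chi R dZ lZ' mZ')) (F := fun q => E p q) qT) => -[s s'].
by apply: rect_coef => // j k jm km; apply: H.
Qed.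

(** With only the constant character missing on the right, the expansion of a row of [E] over the
    second rectangle reduces to its constant term. *)
Lemma rect_const p q q' :
  (forall j k j' k', (j < mY)%N -> (k < mZ)%N -> (j' < mY')%N -> (k' < mZ')%N ->
    (j', k') != (0, 0)%N -> sform E (f j k) (g j' k') = 0) ->
  p \in T -> q \in T' -> q' \in T' -> E p q = E p q'.
Proof.
case/and4P: (pos) => _ _ a b H pT.
apply: (tight_const_conj (n0 a b) (tight_tens (@tight_chi R dY lY' mY')
  (@tight_chi R dZ lZ' mZ')) (s0 := (Ordinal a, Ordinal b)) (F := fun q => E p q)).
  by move=> [y z] /andP[/= yI zI]; rewrite tens2E /= !chi0 ?mulr1.
by move=> [s s'] ss; apply: rect_coef => // j k jm km; apply: H.
Qed.
End Rectangles.

End TwoParty.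

(** * Operators on two parties *)

Section Rotor.
Variable R : realType.
Local Notation C := (R[i]).

Definition rect dY dZ (T : (nat * nat) * (nat * nat)) :=
  [pred p : 'I_dY * 'I_dZ |
    (p.1 \in segm dY T.1.1 T.1.2) && (p.2 \in segm dZ T.2.1 T.2.2)].

Definition rchi dY dZ (T : (nat * nat) * (nat * nat)) j k :=
  tens2 (chi R dY T.1.1 T.1.2 j) (chi R dZ T.2.1 T.2.2 k).

Definition rdisj (T T' : (nat * nat) * (nat * nat)) :=
  [|| T.1.1 + T.1.2 <= T'.1.1, T'.1.1 + T'.1.2 <= T.1.1,
      T.2.1 + T.2.2 <= T'.2.1 | T'.2.1 + T'.2.2 <= T.2.1]%N.

Lemma dotp_rchi_disj dY dZ T T' j k j' k' : rdisj T T' ->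
  dotp (rchi dY dZ T j k) (rchi dY dZ T' j' k') = 0.
Proof.
move=> /or4P[] H; rewrite dotp_tens2.
- by rewrite dotp_chi_disjoint ?mul0r // H.
- by rewrite dotp_chi_disjoint ?mul0r // H orbT.
- by rewrite [X in _ * X]dotp_chi_disjoint ?mulr0 // H.
by rewrite [X in _ * X]dotp_chi_disjoint ?mulr0 // H orbT.
Qed.

Section Blocks.
Variables (dX dY dZ : nat) (E : 'I_dY * 'I_dZ -> 'I_dY * 'I_dZ -> C).
Variable P : cvec R 'I_dX -> cvec R ('I_dY * 'I_dZ)%type -> Prop.
Hypothesis orthP : forall a a' f g, P a f -> P a' g -> dotp a a' != 0 ->
  dotp f g = 0 -> sform E f g = 0.

(** [P a f] is to be read as membership of the product of [a] and [f] in the set. Sides satisfy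
    [spans] for a suitable [a], plates only [spans0]. *)
Definition spans a T := forall j k, (j < T.1.2)%N -> (k < T.2.2)%N ->
  P a (rchi dY dZ T j k).
Definition spans0 a T := forall j k, (j < T.1.2)%N -> (k < T.2.2)%N ->
  (j, k) != (0, 0)%N -> P a (rchi dY dZ T j k).

Lemma block_zero a a' T T' p q : spans a T -> spans a' T' ->
  [&& 0 < T.1.2, 0 < T.2.2, 0 < T'.1.2 & 0 < T'.2.2]%N -> rdisj T T' ->
  dotp a a' != 0 -> p \in rect dY dZ T -> q \in rect dY dZ T' -> E p q = 0.
Proof.
move=> sT sT' pos dT aa'; apply: rect_zero => // j k j' k' jm km jm' km'.
by apply: (orthP (sT j k jm km) (sT' j' k' jm' km')) => //; apply: dotp_rchi_disj.
Qed.

Lemma block_const a a' T T' p q q' : spans a T -> spans0 a' T' ->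
  [&& 0 < T.1.2, 0 < T.2.2, 0 < T'.1.2 & 0 < T'.2.2]%N -> rdisj T T' ->
  dotp a a' != 0 -> p \in rect dY dZ T -> q \in rect dY dZ T' ->
  q' \in rect dY dZ T' -> E p q = E p q'.
Proof.
move=> sT sT' pos dT aa'; apply: rect_const => // j k j' k' jm km jm' km' jk.
by apply: (orthP (sT j k jm km) (sT' j' k' jm' km' jk)) => //; apply: dotp_rchi_disj.
Qed.
End Blocks.

Lemma tens2_ones dY dZ :
  tens2 [ffun=> 1] [ffun=> 1] = [ffun=> 1] :> cvec R ('I_dY * 'I_dZ)%type.
Proof. by apply/ffunP => p; rewrite !ffunE mulr1. Qed.

Lemma dotp_ones_chi d l m s : (l + m <= d)%N -> (s < m)%N ->
  dotp [ffun=> 1] (chi R d l m s) = m%:R * (s == 0)%N%:R.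
Proof.
move=> lmd sm; have m0 : (0 < m)%N by apply: leq_ltn_trans sm.
rewrite eq_sym -(dotp_chi R lmd m0 sm); apply: eq_bigr => x _.
have [xI|xI] := boolP (x \in segm d l m); first by rewrite ffunE chi0.
by rewrite [chi R d l m s x]chi_out ?mulr0.
Qed.

Lemma layer0E nX nY nZ : layer nX.+1 nY.+1 nZ.+1 0 =
  [:: ((1, nX), (0, 1), (0, nZ)); ((1, nX), (0, nY), (nZ, 1));
      ((nX, 1), (1, nY), (0, nZ)); ((0, nX), (nY, 1), (1, nZ));
      ((0, nX), (1, nY), (0, 1)); ((0, 1), (0, nY), (1, nZ))]%N.
Proof. by rewrite /layer !muln0 !subn0 !subn1. Qed.

(** * The sides and plates of layer 0 in the two-party grid *)

Section Regions.
Variables nY nZ : nat.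
Hypotheses (nY2 : (2 <= nY)%N) (nZ2 : (2 <= nZ)%N).
(** Projections of the tiles of layer 0 along the first party: [A3r] and [B3r] are the plates, the
    other four are the sides. *)
Definition A1r := ((0, 1), (0, nZ))%N.
Definition A2r := ((0, nY), (nZ, 1))%N.
Definition A3r := ((1, nY), (0, nZ))%N.
Definition B1r := ((nY, 1), (1, nZ))%N.
Definition B2r := ((1, nY), (0, 1))%N.
Definition B3r := ((0, nY), (1, nZ))%N.
Local Notation rc := (rect nY.+1 nZ.+1).

(** Each complement uses the one plate whose first-party ket lies in the interval of that side; the
    other plate cannot be tested against it. *)
Lemma rotor_cover p :
  [/\ p \notin rc A1r -> [\/ p \in rc A2r, p \in rc B1r, p \in rc B2r | p \in rc A3r],
      p \notin rc A2r -> [\/ p \in rc A1r, p \in rc B1r, p \in rc B2r | p \in rc A3r],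
      p \notin rc B1r -> [\/ p \in rc A1r, p \in rc A2r, p \in rc B2r | p \in rc B3r] &
      p \notin rc B2r -> [\/ p \in rc A1r, p \in rc A2r, p \in rc B1r | p \in rc B3r]].
Proof.
move: p => [y z]; have := ltn_ord y; have := ltn_ord z; rewrite !inE /= => zn yn.
by split => H; apply/or4P; move: H; lia.
Qed.

Lemma rotor_disj p q :
  (p \in rc A1r) || (p \in rc A2r) -> (q \in rc B1r) || (q \in rc B2r) -> p != q.
Proof.
move=> pA qB; apply/eqP => pq; move: pA qB; rewrite pq; case: q {pq p} => [y z].
by rewrite !inE /=; have := ltn_ord y; have := ltn_ord z; lia.
Qed.
Let ltp (p : 'I_nY.+1 * 'I_nZ.+1) := (ltn_ord p.1, ltn_ord p.2).

Lemma A1rE p : (p.1 == ord0) && (p.2 != ord_max) = (p \in rc A1r).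
Proof. by have [py pz] := ltp p; rewrite !inE -!val_eqE /=; lia. Qed.

Lemma A2rE p : (p.1 \in segm nY.+1 0 nY) && (p.2 == ord_max) = (p \in rc A2r).
Proof. by have [py pz] := ltp p; rewrite !inE -!val_eqE /=; lia. Qed.

Lemma B1rE p : (p.1 == ord_max) && (p.2 != ord0) = (p \in rc B1r).
Proof. by have [py pz] := ltp p; rewrite !inE -!val_eqE /=; lia. Qed.

Lemma B2rE p : (p.1 \in segm nY.+1 1 nY) && (p.2 == ord0) = (p \in rc B2r).
Proof. by have [py pz] := ltp p; rewrite !inE -!val_eqE /=; lia. Qed.

Lemma out_B3r p : p \notin rc B3r -> p != (ord0, ord0) ->
  p \in rc B1r \/ p \in rc B2r.
Proof.
have [py pz] := ltp p; rewrite [p]surjective_pairing xpair_eqE !inE -!val_eqE /=.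
by move=> H1 H2; apply/orP; move: H1 H2; lia.
Qed.

Lemma out_A3r p : p \notin rc A3r -> p != (ord_max, ord_max) ->
  p \in rc A1r \/ p \in rc A2r.
Proof.
have [py pz] := ltp p; rewrite [p]surjective_pairing xpair_eqE !inE -!val_eqE /=.
by move=> H1 H2; apply/orP; move: H1 H2; lia.
Qed.
End Regions.

Lemma two_party_scalar dX dY dZ
    (P : cvec R 'I_dX -> cvec R ('I_dY * 'I_dZ)%type -> Prop)
    (E : 'I_dY * 'I_dZ -> 'I_dY * 'I_dZ -> C) :
  (3 <= dX)%N -> (3 <= dY)%N -> (3 <= dZ)%N ->
  (forall x y, E y x = conjc (E x y)) ->
  (forall T s1 s2 s3, T \in layer dX dY dZ 0 ->
     (s1 < T.1.1.2)%N -> (s2 < T.1.2.2)%N -> (s3 < T.2.2)%N ->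
     (s1, s2, s3) != (0, 0, 0)%N ->
     P (chi R dX T.1.1.1 T.1.1.2 s1) (rchi dY dZ (T.1.2, T.2) s2 s3)) ->
  P [ffun=> 1] [ffun=> 1] ->
  (forall a a' f g, P a f -> P a' g -> dotp a a' != 0 -> dotp f g = 0 ->
     sform E f g = 0) ->
  exists mu, forall p q, E p q = mu * (p == q)%:R.
Proof.
(* Successor dimensions make the two ends of each range available as [ord0] and [ord_max]. *)
case: dX P => // nX P; case: dY P E => // nY P E; case: dZ P E => // nZ P E.
move=> nX2 nY2 nZ2 herm tiles ones orthP; rewrite ltnS in nX2.
rewrite ltnS in nY2; rewrite ltnS in nZ2.
have nX1 : (0 < nX)%N := ltnW nX2.
have nY1 : (0 < nY)%N := ltnW nY2.
have nZ1 : (0 < nZ)%N := ltnW nZ2.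
(* [a] and [b] are the first-party vectors of the sides, [c] and [e] the kets of the plates. Taking
   the same index 1 in [a] and [b] keeps their overlap nonzero despite the shift. *)
pose a := chi R nX.+1 1 nX 1; pose b := chi R nX.+1 0 nX 1.
pose c := chi R nX.+1 nX 1 0; pose e := chi R nX.+1 0 1 0.
have ab : dotp a b != 0 by have := @dotp_chi_shift R nX.+1 nX2; rewrite subn1.
have aa : dotp a a != 0.
  by rewrite dotp_chi ?add1n // eqxx mulr1 pnatr_eq0 -lt0n.
have bb : dotp b b != 0.
  by rewrite dotp_chi ?add0n // eqxx mulr1 pnatr_eq0 -lt0n.
have ac : dotp a c != 0 by rewrite dotp_chi_ket // nX1 add1n ltnSn.
have be : dotp b e != 0 by rewrite dotp_chi_ket // add0n nX1.
have cc : dotp c c != 0 by rewrite dotp_chi_ket // leqnn addn1 ltnSn.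
have ee : dotp e e != 0 by rewrite dotp_chi_ket.
have mem T : T \in layer nX.+1 nY.+1 nZ.+1 0 -> forall s1 s2 s3,
     (s1 < T.1.1.2)%N -> (s2 < T.1.2.2)%N -> (s3 < T.2.2)%N ->
     (s1, s2, s3) != (0, 0, 0)%N ->
     P (chi R nX.+1 T.1.1.1 T.1.1.2 s1) (rchi nY.+1 nZ.+1 (T.1.2, T.2) s2 s3).
  by move=> TL s1 s2 s3; apply: tiles.
rewrite layer0E in mem.
(* First-party index 1 makes the label nonzero for every [j] and [k]. For the plates below, the only
   first-party index is 0, so [(0, 0)] stays excluded. *)
have sA1 : spans P a (A1r nZ).
  move=> j k jm km; apply: (mem ((1, nX), (0, 1), (0, nZ))%N _ 1%N) => //.
  by rewrite !inE eqxx ?orbT.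
have sA2 : spans P a (A2r nY nZ).
  move=> j k jm km; apply: (mem ((1, nX), (0, nY), (nZ, 1))%N _ 1%N) => //.
  by rewrite !inE eqxx ?orbT.
have sB1 : spans P b (B1r nY nZ).
  move=> j k jm km; apply: (mem ((0, nX), (nY, 1), (1, nZ))%N _ 1%N) => //.
  by rewrite !inE eqxx ?orbT.
have sB2 : spans P b (B2r nY).
  move=> j k jm km; apply: (mem ((0, nX), (1, nY), (0, 1))%N _ 1%N) => //.
  by rewrite !inE eqxx ?orbT.
have sA3 : spans0 P c (A3r nY nZ).
  move=> j k jm km jk; apply: (mem ((nX, 1), (1, nY), (0, nZ))%N _ 0%N) => //.
  by rewrite !inE eqxx ?orbT.
have sB3 : spans0 P e (B3r nY nZ).
  move=> j k jm km jk; apply: (mem ((0, 1), (0, nY), (1, nZ))%N _ 0%N) => //.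
  by rewrite !inE eqxx ?orbT.
have rev x y : E x y = 0 -> E y x = 0 by move=> xy; rewrite herm xy rmorph0.
pose rc := rect nY.+1 nZ.+1.
have [dA1A2 dA1B1 dA1B2 dA2B1 dA2B2] : [/\ rdisj (A1r nZ) (A2r nY nZ),
    rdisj (A1r nZ) (B1r nY nZ), rdisj (A1r nZ) (B2r nY),
    rdisj (A2r nY nZ) (B1r nY nZ) & rdisj (A2r nY nZ) (B2r nY)].
  by move: nY1 nZ1; clear; rewrite /rdisj /=; split; lia.
have [dB1B2 dA1A3 dA2A3 dB1B3 dB2B3] : [/\ rdisj (B1r nY nZ) (B2r nY),
    rdisj (A1r nZ) (A3r nY nZ), rdisj (A2r nY nZ) (A3r nY nZ),
    rdisj (B1r nY nZ) (B3r nY nZ) & rdisj (B2r nY) (B3r nY nZ)].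
  by move: nY1 nZ1; clear; rewrite /rdisj /=; split; lia.
have zA1A2 p q : p \in rc (A1r nZ) -> q \in rc (A2r nY nZ) -> E p q = 0.
  by apply: (block_zero orthP sA1 sA2) => //=; rewrite nY1 nZ1.
have zA1B1 p q : p \in rc (A1r nZ) -> q \in rc (B1r nY nZ) -> E p q = 0.
  by apply: (block_zero orthP sA1 sB1) => //=; rewrite nZ1.
have zA1B2 p q : p \in rc (A1r nZ) -> q \in rc (B2r nY) -> E p q = 0.
  by apply: (block_zero orthP sA1 sB2) => //=; rewrite nZ1 nY1.
have zA2B1 p q : p \in rc (A2r nY nZ) -> q \in rc (B1r nY nZ) -> E p q = 0.
  by apply: (block_zero orthP sA2 sB1) => //=; rewrite nZ1 nY1.
have zA2B2 p q : p \in rc (A2r nY nZ) -> q \in rc (B2r nY) -> E p q = 0.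
  by apply: (block_zero orthP sA2 sB2) => //=; rewrite nY1.
have zB1B2 p q : p \in rc (B1r nY nZ) -> q \in rc (B2r nY) -> E p q = 0.
  by apply: (block_zero orthP sB1 sB2) => //=; rewrite nZ1 nY1.
(* The constant value of a row on a plate vanishes because the plate meets a
   side on which the row is already known to be zero. *)
pose u : 'I_nY.+1 * 'I_nZ.+1 := (@Ordinal nY.+1 1 nY1, ord0).
have uB2 : u \in rc (B2r nY) by rewrite !inE /=; move: nY2; clear; lia.
have uA3 : u \in rc (A3r nY nZ) by rewrite !inE /=; move: nY2 nZ2; clear; lia.
pose v : 'I_nY.+1 * 'I_nZ.+1 := (ord0, ord_max).
have vA2 : v \in rc (A2r nY nZ) by rewrite !inE /=; move: nY2 nZ2; clear; lia.
have vB3 : v \in rc (B3r nY nZ) by rewrite !inE /=; move: nY2 nZ2; clear; lia.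
have zA1A3 p q : p \in rc (A1r nZ) -> q \in rc (A3r nY nZ) -> E p q = 0.
  move=> pA qA; rewrite -(zA1B2 p u) //.
  by apply: (block_const orthP sA1 sA3) => //=; rewrite nY1 nZ1.
have zA2A3 p q : p \in rc (A2r nY nZ) -> q \in rc (A3r nY nZ) -> E p q = 0.
  move=> pA qA; rewrite -(zA2B2 p u) //.
  by apply: (block_const orthP sA2 sA3) => //=; rewrite nY1 nZ1.
have zB1B3 p q : p \in rc (B1r nY nZ) -> q \in rc (B3r nY nZ) -> E p q = 0.
  move=> pA qA; rewrite -(rev _ _ (zA2B1 v p vA2 pA)).
  by apply: (block_const orthP sB1 sB3) => //=; rewrite nY1 nZ1.
have zB2B3 p q : p \in rc (B2r nY) -> q \in rc (B3r nY nZ) -> E p q = 0.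
  move=> pA qA; rewrite -(rev _ _ (zA2B2 v p vA2 pA)).
  by apply: (block_const orthP sB2 sB3) => //=; rewrite nY1 nZ1.
have cov := rotor_cover nY2 nZ2.
have oA1 p q : p \in rc (A1r nZ) -> q \notin rc (A1r nZ) -> E p q = 0.
  move=> pA; have [H _ _ _] := cov q => /H[] qA; [exact: zA1A2|exact: zA1B1|
    exact: zA1B2|exact: zA1A3].
have oA2 p q : p \in rc (A2r nY nZ) -> q \notin rc (A2r nY nZ) -> E p q = 0.
  move=> pA; have [_ H _ _] := cov q => /H[] qA; [by apply: rev; apply: zA1A2|
    exact: zA2B1|exact: zA2B2|exact: zA2A3].
have oB1 p q : p \in rc (B1r nY nZ) -> q \notin rc (B1r nY nZ) -> E p q = 0.
  move=> pA; have [_ _ H _] := cov q => /H[] qA; [by apply: rev; apply: zA1B1|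
    by apply: rev; apply: zA2B1|exact: zB1B2|exact: zB1B3].
have oB2 p q : p \in rc (B2r nY) -> q \notin rc (B2r nY) -> E p q = 0.
  move=> pA; have [_ _ _ H] := cov q => /H[] qA; [by apply: rev; apply: zA1B2|
    by apply: rev; apply: zA2B2|by apply: rev; apply: zB1B2|exact: zB2B3].
(* In dimension at least 3 the point 1 is interior, so it can serve as [za] for both plates. *)
pose o1 : 'I_nZ.+1 := @Ordinal nZ.+1 1 nZ1.
(* For the plate [B3r] the full side is [A2r], the short side [A1r] and the corner [(ord0, ord0)].
   The half-turn of the grid gives the plate [A3r] with [B2r], [B1r] and the opposite corner. *)
have [mu muE] : exists mu, forall p q,
    (p \in rc (B3r nY nZ)) || (p == (ord0, ord0)) ->
    (q \in rc (B3r nY nZ)) || (q == (ord0, ord0)) -> E p q = mu * (p == q)%:R.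
  have g1 : (0 + nY <= nY.+1)%N by rewrite add0n.
  have g2 : (0 + nZ <= nZ.+1)%N by rewrite add0n.
  have g3 : ord0 \in segm nY.+1 0 nY by rewrite inE /= add0n.
  have g4 : ord0 != ord_max :> 'I_nZ.+1 by rewrite -val_eqE /= eq_sym -lt0n.
  have g5 : o1 \in segm nZ.+1 1 nZ by rewrite inE /=; move: nZ2; clear; lia.
  have g6 : o1 != ord_max by rewrite -val_eqE /= neq_ltn nZ2.
  have g7 z : (z \in segm nZ.+1 1 nZ) = (z != ord0).
    by have := ltn_ord z; rewrite inE -val_eqE /=; clear; lia.
  have g8 z : (z \in segm nZ.+1 0 nZ) = (z != ord_max).
    by have := ltn_ord z; rewrite inE -val_eqE /=; clear; lia.
  apply: (core_scalar g1 g2 nY2 nZ2 g3 g4 g5 g6 g7 g8 herm).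
  - by move=> x y; rewrite ![_ \in _](A2rE nY2 nZ2) => xA yA; apply: oA2.
  - by move=> x y; rewrite ![_ \in _](A1rE nY2 nZ2) => xA yA; apply: oA1.
  - by move=> x y xB xn yB; have [xS|xS] := out_B3r nY2 nZ2 xB xn;
      [exact: zB1B3|exact: zB2B3].
  - move=> j j' jm jm' jj; rewrite ket_chi.
    have D : dotp (rchi nY.+1 nZ.+1 (A2r nY nZ) j 0)
        (rchi nY.+1 nZ.+1 (A2r nY nZ) j' 0) = 0.
      by rewrite dotp_tens2 dotp_chi //= (negPf jj) mulr0 mul0r.
    exact: (orthP _ _ _ _ (sA2 j 0%N jm isT) (sA2 j' 0%N jm' isT) aa D).
  - rewrite ket_chi.
    have D : dotp (rchi nY.+1 nZ.+1 (A1r nZ) 0 0) (rchi nY.+1 nZ.+1 (A1r nZ) 0 1) = 0.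
      by rewrite dotp_tens2 [X in _ * X]dotp_chi //= !mulr0.
    exact: (orthP _ _ _ _ (sA1 0%N 0%N isT nZ1) (sA1 0%N 1%N isT nZ2) aa D).
  - move=> j k j' k' jm km jm' km' jk jk' jj.
    have D : dotp (rchi nY.+1 nZ.+1 (B3r nY nZ) j k)
        (rchi nY.+1 nZ.+1 (B3r nY nZ) j' k') = 0.
      rewrite dotp_tens2 !dotp_chi //= mulrACA -[X in _ * X]natrM mulnb.
      by move: jj; rewrite xpair_eqE => /negPf ->; rewrite mulr0.
    exact: (orthP _ _ _ _ (sB3 j k jm km jk) (sB3 j' k' jm' km' jk') ee D).
  - move=> j k jm km jk.
    have D : dotp [ffun=> 1] (rchi nY.+1 nZ.+1 (B3r nY nZ) j k) = 0.
      rewrite -tens2_ones dotp_tens2 !dotp_ones_chi //= mulrACA -[X in _ * X]natrM mulnb.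
      by move: jk; rewrite xpair_eqE => /negPf ->; rewrite mulr0.
    apply: (orthP _ _ _ _ ones (sB3 j k jm km jk) _ D).
    by rewrite dotp_ones_chi ?addn1 // mulr1 oner_eq0.
have [mu' muE'] : exists mu, forall p q,
    (p \in rc (A3r nY nZ)) || (p == (ord_max, ord_max)) ->
    (q \in rc (A3r nY nZ)) || (q == (ord_max, ord_max)) -> E p q = mu * (p == q)%:R.
  have g1 : (1 + nY <= nY.+1)%N by rewrite add1n.
  have g2 : (1 + nZ <= nZ.+1)%N by rewrite add1n.
  have g3 : ord_max \in segm nY.+1 1 nY by rewrite inE /= add1n leqnn andbT.
  have g4 : ord_max != ord0 :> 'I_nZ.+1 by rewrite -val_eqE /= -lt0n.
  have g5 : o1 \in segm nZ.+1 0 nZ by rewrite inE /=.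
  have g6 : o1 != ord0 by rewrite -val_eqE.
  have g7 z : (z \in segm nZ.+1 0 nZ) = (z != ord_max).
    by have := ltn_ord z; rewrite inE -val_eqE /=; clear; lia.
  have g8 z : (z \in segm nZ.+1 1 nZ) = (z != ord0).
    by have := ltn_ord z; rewrite inE -val_eqE /=; clear; lia.
  apply: (core_scalar g1 g2 nY2 nZ2 g3 g4 g5 g6 g7 g8 herm).
  - by move=> x y; rewrite ![_ \in _](B2rE nY2 nZ2) => xA yA; apply: oB2.
  - by move=> x y; rewrite ![_ \in _](B1rE nY2 nZ2) => xA yA; apply: oB1.
  - by move=> x y xB xn yB; have [xS|xS] := out_A3r nY2 nZ2 xB xn;
      [exact: zA1A3|exact: zA2A3].
  - move=> j j' jm jm' jj; rewrite ket_chi.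
    have D : dotp (rchi nY.+1 nZ.+1 (B2r nY) j 0) (rchi nY.+1 nZ.+1 (B2r nY) j' 0) = 0.
      by rewrite dotp_tens2 dotp_chi //= (negPf jj) mulr0 mul0r.
    exact: (orthP _ _ _ _ (sB2 j 0%N jm isT) (sB2 j' 0%N jm' isT) bb D).
  - rewrite ket_chi.
    have D : dotp (rchi nY.+1 nZ.+1 (B1r nY nZ) 0 0)
        (rchi nY.+1 nZ.+1 (B1r nY nZ) 0 1) = 0.
      by rewrite dotp_tens2 [X in _ * X]dotp_chi //= !mulr0.
    exact: (orthP _ _ _ _ (sB1 0%N 0%N isT nZ1) (sB1 0%N 1%N isT nZ2) bb D).
  - move=> j k j' k' jm km jm' km' jk jk' jj.
    have D : dotp (rchi nY.+1 nZ.+1 (A3r nY nZ) j k)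
        (rchi nY.+1 nZ.+1 (A3r nY nZ) j' k') = 0.
      rewrite dotp_tens2 !dotp_chi //= mulrACA -[X in _ * X]natrM mulnb.
      by move: jj; rewrite xpair_eqE => /negPf ->; rewrite mulr0.
    exact: (orthP _ _ _ _ (sA3 j k jm km jk) (sA3 j' k' jm' km' jk') cc D).
  - move=> j k jm km jk.
    have D : dotp [ffun=> 1] (rchi nY.+1 nZ.+1 (A3r nY nZ) j k) = 0.
      rewrite -tens2_ones dotp_tens2 !dotp_ones_chi //= mulrACA -[X in _ * X]natrM mulnb.
      by move: jk; rewrite xpair_eqE => /negPf ->; rewrite mulr0.
    apply: (orthP _ _ _ _ ones (sA3 j k jm km jk) _ D).
    by rewrite dotp_ones_chi ?addn1 // mulr1 oner_eq0.
(* The plates share the point [(1, 1)], whose diagonal entry identifies the two scalars. *)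
have [m1 m2] : ((@Ordinal nY.+1 1 nY1, o1) \in rc (B3r nY nZ)) /\
    ((@Ordinal nY.+1 1 nY1, o1) \in rc (A3r nY nZ)).
  by rewrite !inE /=; move: nY2 nZ2; clear; lia.
have mm : mu' = mu.
  have i1 := introT orP (or_introl m1); have i2 := introT orP (or_introl m2).
  have := muE _ _ (i1 _) (i1 _); rewrite (muE' _ _ (i2 _) (i2 _)).
  by rewrite eqxx !mulr1.
exists mu => p q.
pose D := [pred p | (p \in rc (B3r nY nZ)) || (p == (ord0, ord0))].
pose D' := [pred p | (p \in rc (A3r nY nZ)) || (p == (ord_max, ord_max))].
have outD x : x \notin D -> x \in rc (B1r nY nZ) \/ x \in rc (B2r nY).
  by rewrite inE negb_or => /andP[xB xn]; apply: out_B3r xB xn.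
have outD' x : x \notin D' -> x \in rc (A1r nZ) \/ x \in rc (A2r nY nZ).
  by rewrite inE negb_or => /andP[xB xn]; apply: out_A3r xB xn.
(* A pair contained in neither enlarged plate joins a side of type A to a side of type B, where [E]
   vanishes. *)
have AB x y : x \notin D' -> y \notin D -> E x y = mu * (x == y)%:R.
  move=> xD yD; have xA := outD' x xD; have yB := outD y yD.
  rewrite (negPf (rotor_disj nY2 nZ2 (introT orP xA) (introT orP yB))) mulr0.
  by case: xA => xA; case: yB => yB;
    [exact: zA1B1|exact: zA1B2|exact: zA2B1|exact: zA2B2].
have DD x : (x \in D) || (x \in D').
  have [//|xD] := boolP (x \in D); have [//|xD'] := boolP (x \in D').
  have := rotor_disj nY2 nZ2 (introT orP (outD' x xD')) (introT orP (outD x xD)).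
  by rewrite eqxx.
have [pD|pD] := boolP (p \in D); have [qD|qD] := boolP (q \in D).
- exact: muE.
- have [pD'|pD'] := boolP (p \in D'); last exact: AB.
  by rewrite -mm; apply: muE' => //; move: (DD q); rewrite (negPf qD).
- have [qD'|qD'] := boolP (q \in D').
    by rewrite -mm; apply: muE' => //; move: (DD p); rewrite (negPf pD).
  have [pq|pq] := eqVneq p q; first by rewrite pq qD in pD.
  by rewrite mulr0; apply: rev; rewrite AB // eq_sym (negPf pq) mulr0.
by rewrite -mm; apply: muE'; [move: (DD p) | move: (DD q)]; rewrite (negPf pD, negPf qD).
Qed.

End Rotor.

(** * Local irreducibility *)

Section LocalOperators.
Variable R : realType.
Local Notation C := (R[i]).

Definition act (X : finType) (M : op R X) (f : cvec R X) : cvec R X :=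
  [ffun x => \sum_x' M (x, x') * f x'].

Definition gram (X : finType) (M : op R X) (x x' : X) : C :=
  \sum_z conjc (M (z, x)) * M (z, x').

(** The value [mu = 0] is allowed and means that [M] is zero. *)
Definition isometric (X : finType) (M : op R X) (mu : C) :=
  forall x x', gram M x x' = mu * (x == x')%:R.

Definition opmul (X : finType) (M N : op R X) : op R X :=
  [ffun p => \sum_z M (p.1, z) * N (z, p.2)].

Lemma gram_herm (X : finType) (M : op R X) x y : gram M y x = conjc (gram M x y).
Proof.
rewrite /gram rmorph_sum; apply: eq_bigr => z _.
by rewrite rmorphM /= conjcK mulrC.
Qed.

Lemma dotp_act (X : finType) (M : op R X) f g :
  dotp (act M f) (act M g) = sform (gram M) f g.
Proof.
transitivity (\sum_z \sum_x \sum_y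
    conjc (f x) * (conjc (M (z, x)) * M (z, y) * g y)).
  apply: eq_bigr => z _; rewrite !ffunE rmorph_sum mulr_suml.
  apply: eq_bigr => x _; rewrite mulr_sumr; apply: eq_bigr => y _.
  by rewrite rmorphM /=; ring.
rewrite exchange_big; apply: eq_bigr => x _ /=; rewrite exchange_big mulr_sumr.
by apply: eq_bigr => y _ /=; rewrite /gram mulr_suml mulr_sumr.
Qed.

Lemma sform_isometric (X : finType) (M : op R X) mu f g : isometric M mu ->
  sform (gram M) f g = mu * dotp f g.
Proof.
move=> iM; rewrite /dotp mulr_sumr; apply: eq_bigr => x _.
rewrite [RHS]mulrCA -(sum_delta x (fun y => mu * g y)); congr (_ * _).
by apply: eq_bigr => y _; rewrite iM; ring.
Qed.

Section Bipartite.
Variables X Y : finType.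
Implicit Types (M : op R X) (N : op R Y) (u v : cvec R (X * Y)%type).

Definition slicel u (y : Y) : cvec R X := [ffun x => u (x, y)].
Definition slicer u (x : X) : cvec R Y := [ffun y => u (x, y)].

Lemma dotp_slicel u v : dotp u v = \sum_y dotp (slicel u y) (slicel v y).
Proof.
rewrite /dotp sum_prod exchange_big; apply: eq_bigr => y _.
by apply: eq_bigr => x _; rewrite !ffunE.
Qed.

Lemma dotp_slicer u v : dotp u v = \sum_x dotp (slicer u x) (slicer v x).
Proof.
rewrite /dotp sum_prod; apply: eq_bigr => x _.
by apply: eq_bigr => y _; rewrite !ffunE.
Qed.

Lemma slicel_apply M u y : slicel (apply_left M u) y = act M (slicel u y).
Proof. by apply/ffunP => x; rewrite !ffunE; apply: eq_bigr => z _; rewrite !ffunE. Qed.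

Lemma slicer_apply N u x : slicer (apply_right N u) x = act N (slicer u x).
Proof. by apply/ffunP => y; rewrite !ffunE; apply: eq_bigr => z _; rewrite !ffunE. Qed.

Lemma dotp_left_isometric M mu u v : isometric M mu ->
  dotp (apply_left M u) (apply_left M v) = mu * dotp u v.
Proof.
move=> iM; rewrite !dotp_slicel mulr_sumr; apply: eq_bigr => y _.
by rewrite !slicel_apply dotp_act (sform_isometric _ _ iM).
Qed.

Lemma dotp_right_isometric N mu u v : isometric N mu ->
  dotp (apply_right N u) (apply_right N v) = mu * dotp u v.
Proof.
move=> iN; rewrite !dotp_slicer mulr_sumr; apply: eq_bigr => y _.
by rewrite !slicer_apply dotp_act (sform_isometric _ _ iN).
Qed.

Lemma apply_right_tens N (a : cvec R X) (f : cvec R Y) :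
  apply_right N (tens2 a f) = tens2 a (act N f).
Proof.
apply/ffunP => p; rewrite !ffunE mulr_sumr; apply: eq_bigr => y _.
by rewrite ffunE /=; ring.
Qed.

Lemma apply_left_comp M M' u :
  apply_left M (apply_left M' u) = apply_left (opmul M M') u.
Proof.
apply/ffunP => -[x y]; rewrite !ffunE /=.
under eq_bigr do rewrite ffunE mulr_sumr.
rewrite exchange_big; apply: eq_bigr => z _ /=.
by rewrite ffunE mulr_suml; apply: eq_bigr => w _; rewrite mulrA.
Qed.

Lemma apply_right_comp N N' u :
  apply_right N (apply_right N' u) = apply_right (opmul N N') u.
Proof.
apply/ffunP => -[x y]; rewrite !ffunE /=.
under eq_bigr do rewrite ffunE mulr_sumr.
rewrite exchange_big; apply: eq_bigr => z _ /=.
by rewrite ffunE mulr_suml; apply: eq_bigr => w _; rewrite mulrA.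
Qed.

Lemma apply_left_right M N u :
  apply_left M (apply_right N u) = apply_right N (apply_left M u).
Proof.
apply/ffunP => -[x y]; rewrite !ffunE /=.
under eq_bigr do rewrite ffunE mulr_sumr.
rewrite exchange_big; apply: eq_bigr => z _ /=.
by rewrite ffunE mulr_sumr; apply: eq_bigr => w _ /=; ring.
Qed.

Lemma apply_left0 M : apply_left M (0 : cvec R (X * Y)%type) = 0.
Proof. by apply/ffunP => p; rewrite !ffunE big1 // => z _; rewrite ffunE mulr0. Qed.

Lemma apply_right0 N : apply_right N (0 : cvec R (X * Y)%type) = 0.
Proof. by apply/ffunP => p; rewrite !ffunE big1 // => z _; rewrite ffunE mulr0. Qed.

Definition left_rigid (S : seq (cvec R (X * Y)%type)) :=
  forall M, preserves_orth S (apply_left M) -> exists mu, isometric M mu.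
Definition right_rigid (S : seq (cvec R (X * Y)%type)) :=
  forall N, preserves_orth S (apply_right N) -> exists mu, isometric N mu.

(* Up to a local similarity, no measurement changes the set, unless it
   annihilates all of it. *)
Definition similar_or_null S S' :=
  (exists M N al be, [/\ isometric M al, isometric N be, al != 0, be != 0 &
      S' = map (fun u => apply_left M (apply_right N u)) S])
  \/ {in S', forall u, u = 0}.

(** The new operator is composed with the one already accumulated on its side. The isometric factor
    on the other side only rescales inner products by a nonzero number, so the composite preserves
    orthogonality of the original set and rigidity of [S] applies to it. *)
Lemma similar_step S S' S'' : left_rigid S -> right_rigid S ->
  similar_or_null S S' -> local_OP_step S' S'' -> similar_or_null S S''.
Proof.
move=> lS rS [[M [N [al [be [iM iN al0 be0 ->]]]]]|null]; last first.
  case=> [] [K [L [k [_ [_ ->]]]]]; right=> _ /mapP[u /null -> ->].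
    exact: apply_left0.
  exact: apply_right0.
case=> [] [K [L [k [_ [oL ->]]]]].
  have [|mu imu] := lS (opmul (L k) M).
    move=> i j iS jS ij; have := oL k i j; rewrite size_map => /(_ iS jS ij).
    rewrite !(nth_map 0) // !apply_left_comp !apply_left_right.
    rewrite (dotp_right_isometric _ _ iN) => /eqP.
    by rewrite mulf_eq0 (negPf be0) => /eqP.
  have E : map (apply_left (L k)) (map (fun u => apply_left M (apply_right N u)) S)
      = map (fun u => apply_left (opmul (L k) M) (apply_right N u)) S.
    by rewrite -map_comp; apply: eq_map => u /=; rewrite apply_left_comp.
  rewrite E; have [m0|m0] := eqVneq mu 0; last by left; exists (opmul (L k) M), N, mu, be.
  right => _ /mapP[u _ ->]; apply: dotpp_eq0.
  by rewrite (dotp_left_isometric _ _ imu) m0 mul0r.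
have [|mu imu] := rS (opmul (L k) N).
  move=> i j iS jS ij; have := oL k i j; rewrite size_map => /(_ iS jS ij).
  rewrite !(nth_map 0) // -!apply_left_right !apply_right_comp.
  rewrite (dotp_left_isometric _ _ iM) => /eqP.
  by rewrite mulf_eq0 (negPf al0) => /eqP.
have E : map (apply_right (L k)) (map (fun u => apply_left M (apply_right N u)) S)
    = map (fun u => apply_left M (apply_right (opmul (L k) N) u)) S.
  by rewrite -map_comp; apply: eq_map => u /=; rewrite -apply_left_right apply_right_comp.
rewrite E; have [m0|m0] := eqVneq mu 0; last by left; exists M, (opmul (L k) N), al, mu.
right => _ /mapP[u _ ->]; apply: dotpp_eq0.
by rewrite (dotp_left_isometric _ _ iM) (dotp_right_isometric _ _ imu) m0 mul0r mulr0.
Qed.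

Lemma similar_reachable S S' S'' : left_rigid S -> right_rigid S ->
  OP_reachable S' S'' -> similar_or_null S S' -> similar_or_null S S''.
Proof.
move=> lS rS; elim=> [//|{}S' S1 S2 st _ IH sim].
by apply: IH; apply: similar_step st.
Qed.

Definition op1 (T : finType) : op R T := [ffun p => (p.1 == p.2)%:R].

Lemma op1_isometric (T : finType) : isometric (op1 T) 1.
Proof.
move=> x y; rewrite mul1r /gram -[RHS](sum_delta x (fun z => (z == y)%:R)).
by apply: eq_bigr => z _; rewrite !ffunE /= rmorph_nat eq_sym mulrC.
Qed.

Lemma apply_op1 u : apply_left (op1 X) (apply_right (op1 Y) u) = u.
Proof.
rewrite apply_left_right; apply/ffunP => -[x y]; rewrite ffunE /=.
rewrite -[RHS](sum_delta y (fun z => u (x, z))); apply: eq_bigr => z _.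
rewrite !ffunE /= mulrC; congr (_ * _).
rewrite -[RHS](sum_delta x (fun w => u (w, z))); apply: eq_bigr => w _.
by rewrite !ffunE /= mulrC.
Qed.

(** Nonzero multiples of isometries annihilate no nonzero state, and the null alternative leaves no
    state at all. *)
Lemma rigid_irreducible S : left_rigid S -> right_rigid S ->
  {in S, forall u, u != 0} -> locally_irreducible S.
Proof.
move=> lS rS S0 [S' [reach [[i [iS' i0]] [j [jS' j0]]]]].
have: similar_or_null S S'.
  apply: (similar_reachable lS rS reach); left.
  exists (op1 X), (op1 Y), 1, 1; split; rewrite ?oner_eq0 //; try exact: op1_isometric.
  by rewrite -[LHS]map_id; apply: eq_map => u; rewrite apply_op1.
case=> [[M [N [al [be [iM iN al0 be0 E]]]]]|null]; last first.
  by move/eqP: j0; apply; apply: null; apply: mem_nth.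
move: iS' i0; rewrite E size_map => iS; rewrite (nth_map 0) // => i0.
have := dotp_left_isometric (apply_right N (nth 0 S i)) (apply_right N (nth 0 S i)) iM.
rewrite i0 dotp0 (dotp_right_isometric _ _ iN) => /eqP.
rewrite eq_sym !mulf_eq0 (negPf al0) (negPf be0) /= => /eqP/dotpp_eq0/eqP.
by apply/negP; apply: S0; apply: mem_nth.
Qed.
End Bipartite.

Definition rot (X Y Z : finType) (w : cvec R (X * (Y * Z))%type) :
  cvec R (Z * (X * Y))%type := [ffun p => w (p.2.1, (p.2.2, p.1))].

Lemma dotp_rot (X Y Z : finType) (u v : cvec R (X * (Y * Z))%type) :
  dotp (rot u) (rot v) = dotp u v.
Proof.
rewrite /dotp !sum_prod; under [RHS]eq_bigr do rewrite sum_prod.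
rewrite exchange_big sum_prod; apply: eq_bigr => x _; apply: eq_bigr => y _.
by apply: eq_bigr => z _; rewrite !ffunE.
Qed.

(* A one-party operator [M] is [M] tensored with the identity on a second party. *)
Lemma left_rigid_rot (X Y Z : finType) (y0 : Y) (S : seq (cvec R (X * (Y * Z))%type)) :
  right_rigid (map (@rot X Y Z) S) -> left_rigid S.
Proof.
move=> rS M oM.
pose N : op R (X * Y)%type := [ffun p => M (p.1.1, p.2.1) * (p.1.2 == p.2.2)%:R].
have NM w : apply_right N (rot w) = rot (apply_left M w).
  apply/ffunP => -[z [x y]]; rewrite !ffunE /= sum_prod; apply: eq_bigr => x' _.
  rewrite -(sum_delta y (fun y' => M (x, x') * w (x', (y', z)))).
  by apply: eq_bigr => y' _; rewrite !ffunE /=; ring.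
have [|mu imu] := rS N.
  move=> i j; rewrite size_map => iS jS ij.
  by rewrite !(nth_map 0) // !NM dotp_rot oM.
exists mu => x x'; have := imu (x, y0) (x', y0).
rewrite xpair_eqE eqxx andbT => <-; rewrite /gram sum_prod; apply: eq_bigr => z _.
rewrite -[LHS](sum_delta y0 (fun=> conjc (M (z, x)) * M (z, x'))).
apply: eq_bigr => y _; rewrite !ffunE /= rmorphM rmorph_nat /= [y == y0]eq_sym.
by case: (y0 == y); rewrite ?mulr1 ?mulr0 ?mul0r.
Qed.
End LocalOperators.

(** * Strong nonlocality from the outermost layer and the stopper *)

Section StrongNonlocality.
Variable R : realType.
Local Notation C := (R[i]).

Lemma preserves_orth_neq (T : finType) (S : seq (cvec R T)) f u v :
  preserves_orth S f -> u \in S -> v \in S -> u != v -> dotp (f u) (f v) = 0.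
Proof.
move=> oS uS vS uv; have := oS (index u S) (index v S).
rewrite !index_mem !nth_index //; apply=> //.
by apply: contra uv => /eqP /(congr1 (nth 0 S)); rewrite !nth_index // => ->.
Qed.

Lemma right_rigid_layer dX dY dZ (S : seq (cvec R ('I_dX * ('I_dY * 'I_dZ))%type)) :
  (3 <= dX)%N -> (3 <= dY)%N -> (3 <= dZ)%N ->
  (forall T s1 s2 s3, T \in layer dX dY dZ 0 ->
     (s1 < T.1.1.2)%N -> (s2 < T.1.2.2)%N -> (s3 < T.2.2)%N ->
     (s1, s2, s3) != (0, 0, 0)%N ->
     tens2 (chi R dX T.1.1.1 T.1.1.2 s1) (rchi R dY dZ (T.1.2, T.2) s2 s3) \in S) ->
  [ffun=> 1] \in S -> right_rigid S.
Proof.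
move=> dX3 dY3 dZ3 tiles ones N oN.
apply: (@two_party_scalar R dX dY dZ (fun a f => tens2 a f \in S)) => //.
- exact: gram_herm.
- suff -> : tens2 [ffun=> 1] [ffun=> 1] = [ffun=> 1] :>
    cvec R ('I_dX * ('I_dY * 'I_dZ))%type by [].
  by apply/ffunP => p; rewrite !ffunE mulr1.
move=> a a' f g aS a'S aa' fg.
have o0 : dotp (tens2 a f) (tens2 a' g) = 0 by rewrite dotp_tens2 fg mulr0.
suff /eqP : dotp (apply_right N (tens2 a f)) (apply_right N (tens2 a' g)) = 0.
  by rewrite !apply_right_tens dotp_tens2 mulf_eq0 (negPf aa') dotp_act => /eqP.
(* Orthogonality is preserved only between different states; if the two products coincide, [o0]
   makes this vector its own orthogonal, hence zero. *)
have [e|ne] := eqVneq (tens2 a f) (tens2 a' g); last exact: (preserves_orth_neq oN aS a'S ne).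
by rewrite -e (dotpp_eq0 (u := tens2 a f)) ?apply_right0 ?dotp0 // {2}e.
Qed.

Section Cyc.
Variables dA dB dC : nat.
Implicit Types v : cvec R (T3 dA dB dC).

Lemma bip_A_tens3 a b c :
  bip_A (@tens3 R dA dB dC a b c) = tens2 a (tens2 b c).
Proof. by apply/ffunP => -[x [y z]]; rewrite !tens2E !ffunE /=; ring. Qed.

Lemma bip_B_tens3 a b c :
  bip_B (@tens3 R dA dB dC a b c) = tens2 b (tens2 c a).
Proof. by apply/ffunP => -[x [y z]]; rewrite !tens2E !ffunE /=; ring. Qed.

Lemma bip_C_tens3 a b c :
  bip_C (@tens3 R dA dB dC a b c) = tens2 c (tens2 a b).
Proof. by apply/ffunP => -[x [y z]]; rewrite !tens2E !ffunE /=; ring. Qed.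

Lemma rot_bip_A v : rot (bip_A v) = bip_C v.
Proof. by apply/ffunP => -[x [y z]]; rewrite !ffunE. Qed.

Lemma rot_bip_B v : rot (bip_B v) = bip_A v.
Proof. by apply/ffunP => -[x [y z]]; rewrite !ffunE. Qed.

Lemma rot_bip_C v : rot (bip_C v) = bip_B v.
Proof. by apply/ffunP => -[x [y z]]; rewrite !ffunE. Qed.

Lemma bip_A_eq0 v : bip_A v = 0 -> v = 0.
Proof.
move=> /ffunP v0; apply/ffunP => -[[x y] z].
by have := v0 (x, (y, z)); rewrite !ffunE.
Qed.

Lemma bip_B_eq0 v : bip_B v = 0 -> v = 0.
Proof.
move=> /ffunP v0; apply/ffunP => -[[x y] z].
by have := v0 (y, (z, x)); rewrite !ffunE.
Qed.

Lemma bip_C_eq0 v : bip_C v = 0 -> v = 0.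
Proof.
move=> /ffunP v0; apply/ffunP => -[[x y] z].
by have := v0 (z, (x, y)); rewrite !ffunE.
Qed.

Definition tstate (T : tile) s1 s2 s3 : cvec R (T3 dA dB dC) :=
  tens3 (chi R dA T.1.1.1 T.1.1.2 s1) (chi R dB T.1.2.1 T.1.2.2 s2)
        (chi R dC T.2.1 T.2.2 s3).

(** Rotating the parties permutes the tiles in two cycles, A1, B2, B3 and A2, A3, B1, so one
    analysis serves all bipartitions. *)
Lemma layer_cyc dX dY dZ t T :
  T \in layer dY dZ dX t -> (T.2, T.1.1, T.1.2) \in layer dX dY dZ t.
Proof.
case: T => [[i j] k]; rewrite !inE.
by do ![case/orP] => /eqP[-> -> ->]; rewrite eqxx ?orbT.
Qed.

(** Two-party rigidity in the three bipartitions suffices: the single party A is contained in the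
    pair of $C|AB$, B in that of $A|BC$, and C in that of $B|CA$. *)
Lemma strongly_nonlocal_layer (U : seq (cvec R (T3 dA dB dC))) :
  (3 <= dA)%N -> (3 <= dB)%N -> (3 <= dC)%N ->
  (forall T s1 s2 s3, T \in layer dA dB dC 0 ->
     (s1 < T.1.1.2)%N -> (s2 < T.1.2.2)%N -> (s3 < T.2.2)%N ->
     (s1, s2, s3) != (0, 0, 0)%N -> tstate T s1 s2 s3 \in U) ->
  stopper R dA dB dC \in U -> {in U, forall u, u != 0} -> strongly_nonlocal U.
Proof.
move=> dA3 dB3 dC3 tiles stop U0.
have ones3 (X Y Z : finType) :
  tens2 [ffun=> 1] (tens2 [ffun=> 1] [ffun=> 1]) = [ffun=> 1] :> cvec R (X * (Y * Z))%type.
  by apply/ffunP => p; rewrite !ffunE !mulr1.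
have rA : right_rigid (map (@bip_A R dA dB dC) (undup U)).
  apply: right_rigid_layer => // [T s1 s2 s3 TL l1 l2 l3 s0|].
    apply/mapP; exists (tstate T s1 s2 s3); first by rewrite mem_undup tiles.
    by rewrite bip_A_tens3.
  by apply/mapP; exists (stopper R dA dB dC); rewrite ?mem_undup // bip_A_tens3 ones3.
have rB : right_rigid (map (@bip_B R dA dB dC) (undup U)).
  apply: right_rigid_layer => // [T s1 s2 s3 /layer_cyc TL l1 l2 l3 s0|].
    apply/mapP; exists (tstate (T.2, T.1.1, T.1.2) s3 s1 s2); last by rewrite bip_B_tens3.
    rewrite mem_undup tiles //; move: s0; rewrite !xpair_eqE.
    by case: (s1 == 0)%N; case: (s2 == 0)%N; case: (s3 == 0)%N.
  by apply/mapP; exists (stopper R dA dB dC); rewrite ?mem_undup // bip_B_tens3 ones3.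
have rC : right_rigid (map (@bip_C R dA dB dC) (undup U)).
  apply: right_rigid_layer => // [T s1 s2 s3 /layer_cyc/layer_cyc TL l1 l2 l3 s0|].
    apply/mapP; exists (tstate (T.1.2, T.2, T.1.1) s2 s3 s1); last by rewrite bip_C_tens3.
    rewrite mem_undup tiles //; move: s0; rewrite !xpair_eqE.
    by case: (s1 == 0)%N; case: (s2 == 0)%N; case: (s3 == 0)%N.
  by apply/mapP; exists (stopper R dA dB dC); rewrite ?mem_undup // bip_C_tens3 ones3.
have [a0 b0 c0] : [/\ (0 < dA)%N, (0 < dB)%N & (0 < dC)%N] by split; lia.
have m2 X (f : cvec R (T3 dA dB dC) -> cvec R X) : (forall v, f v = 0 -> v = 0) ->
    {in map f (undup U), forall u, u != 0}.
  move=> f0 w /mapP[u]; rewrite mem_undup => uU ->.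
  by apply: contra (U0 u uU) => /eqP/f0 ->.
split; apply: rigid_irreducible => //.
- apply: (left_rigid_rot (Ordinal b0)); rewrite -map_comp.
  by rewrite (eq_map (g := @bip_C R dA dB dC)) // => v; apply: rot_bip_A.
- by apply: m2; exact: bip_A_eq0.
- apply: (left_rigid_rot (Ordinal c0)); rewrite -map_comp.
  by rewrite (eq_map (g := @bip_A R dA dB dC)) // => v; apply: rot_bip_B.
- by apply: m2; exact: bip_B_eq0.
- apply: (left_rigid_rot (Ordinal a0)); rewrite -map_comp.
  by rewrite (eq_map (g := @bip_B R dA dB dC)) // => v; apply: rot_bip_C.
by apply: m2; exact: bip_C_eq0.
Qed.

Lemma sum_ket_nat d a b e (F : nat -> C) (x : 'I_d) :
  (\sum_(a <= r < b) F r *: ket R d (r + e)) x =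
  if (a + e <= x < b + e)%N then F (x - e)%N else 0.
Proof.
rewrite sum_ffunE; case: ifP => xab.
  have xe : (x - e)%N \in index_iota a b by rewrite mem_index_iota; lia.
  rewrite (bigD1_seq (x - e)%N) ?iota_uniq //= big1_seq.
    by rewrite addr0 !ffunE subnK ?eqxx; [exact: mulr1 | lia].
  move=> r /andP[rx _]; rewrite !ffunE (_ : (_ == _) = false); first exact: mulr0.
  by apply/negbTE; apply: contra rx; lia.
apply: big1_seq => r /andP[_]; rewrite mem_index_iota => rab; rewrite !ffunE.
rewrite (_ : (_ == _) = false); first exact: mulr0.
by apply/negbTE; apply/negP => /eqP xr; move: xab; rewrite xr; lia.
Qed.

Lemma eta_chi d t s : Defs.eta R d t s = chi R d t (d - 2 * t - 1) s.
Proof.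
apply/ffunP => x; rewrite /Defs.eta.
under eq_bigr do rewrite -[X in ket R d X]addn0.
rewrite sum_ket_nat ffunE subn0 !addn0.
by congr (if _ then _ else _); lia.
Qed.

Lemma xi_chi d t s : xi R d t s = chi R d t.+1 (d - 2 * t - 1) s.
Proof.
apply/ffunP => x; rewrite /xi.
under eq_bigr do rewrite -[X in ket R d X]addn1.
rewrite sum_ket_nat ffunE -[(x - 1 - t)%N]subnDA add1n.
by congr (if _ then _ else _); lia.
Qed.

Lemma beta_chi d t s : beta R d t s = chi R d t.+1 (d - 2 * t - 2) s.
Proof.
apply/ffunP => x; rewrite /beta.
under eq_bigr do rewrite -[X in ket R d X]addn1.
rewrite sum_ket_nat ffunE -[(x - 1 - t)%N]subnDA add1n.
by congr (if _ then _ else _); lia.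
Qed.

Definition core_tile n : tile :=
  ((n.+1, dA - 2 * n - 2), (n.+1, dB - 2 * n - 2), (n.+1, dC - 2 * n - 2))%N.

Definition tiles n : seq tile :=
  flatten [seq layer dA dB dC t | t <- iota 0 n.+1] ++ [:: core_tile n].

Definition tstates (T : tile) :=
  [seq tstate T s.1.1 s.1.2 s.2 | s <- triples T.1.1.2 T.1.2.2 T.2.2].

End Cyc.
End StrongNonlocality.

(** * The tiles of the basis *)

(** A factor of length one has only the label 0, so the two-index families of the definition are
    three-index families of tiles. *)
Lemma triples12 p q : triples p q 1 = [seq (x.1, x.2, 0%N) | x <- pairs p q].
Proof.
transitivity (seq.filter (fun x => x != (0, 0, 0)%N)
  [seq (x.1, x.2, 0%N) | x <- [seq (i, j) | i <- iota 0 p, j <- iota 0 q]]).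
  by rewrite /triples; congr (seq.filter _ _); rewrite map_allpairs allpairs1r allpairs_mapr.
rewrite filter_map; congr (map _ _); apply: eq_filter => -[i j].
by rewrite /= !xpair_eqE ?andbT.
Qed.

Lemma triples13 p r : triples p 1 r = [seq (x.1, 0%N, x.2) | x <- pairs p r].
Proof.
transitivity (seq.filter (fun x => x != (0, 0, 0)%N)
  [seq (x.1, 0%N, x.2) | x <- [seq (i, j) | i <- iota 0 p, j <- iota 0 r]]).
  by rewrite /triples; congr (seq.filter _ _); rewrite map_allpairs /= cats0 allpairs_mapr.
rewrite filter_map; congr (map _ _); apply: eq_filter => -[i j].
by rewrite /= !xpair_eqE ?andbT.
Qed.

Lemma triples23 q r : triples 1 q r = [seq (0%N, x.1, x.2) | x <- pairs q r].
Proof.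
transitivity (seq.filter (fun x => x != (0, 0, 0)%N)
  [seq (0%N, x.1, x.2) | x <- [seq (i, j) | i <- iota 0 q, j <- iota 0 r]]).
  by rewrite /triples; congr (seq.filter _ _); rewrite /= cats0.
by rewrite filter_map.
Qed.

Definition grid p q r : seq (nat * nat * nat) :=
  [seq (i, jk.1, jk.2) | i <- iota 0 p, jk <- [seq (j, k) | j <- iota 0 q, k <- iota 0 r]].

Lemma grid_uniq p q r : uniq (grid p q r).
Proof.
apply: allpairs_uniq; rewrite ?iota_uniq //.
  by apply: allpairs_uniq; rewrite ?iota_uniq // => -[a b] [c d].
by move=> [i [j k]] [i' [j' k']] _ _ /= [-> -> ->].
Qed.

Lemma mem_grid p q r i j k :
  ((i, j, k) \in grid p q r) = [&& i < p, j < q & k < r]%N.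
Proof.
apply/allpairsP/and3P => [[[i' [j' k']]] /= [ip /allpairsP[[j'' k''] /= [jq kr]]]|[ip jq kr]].
  by move=> [-> ->] [-> -> ->]; move: ip jq kr; rewrite !mem_iota.
exists (i, (j, k)); split; rewrite ?mem_iota //=.
by apply/allpairsP; exists (j, k); rewrite !mem_iota.
Qed.

Lemma triples_uniq p q r : uniq (triples p q r).
Proof. by rewrite filter_uniq ?grid_uniq. Qed.

Lemma mem_triples p q r i j k : ((i, j, k) \in triples p q r) =
  [&& (i, j, k) != (0, 0, 0)%N, i < p, j < q & k < r]%N.
Proof. by rewrite mem_filter mem_grid. Qed.

Lemma size_triples p q r : [&& 0 < p, 0 < q & 0 < r]%N ->
  size (triples p q r) = (p * q * r - 1)%N.
Proof.
move=> pos; rewrite -[LHS]/(size (seq.filter (predC1 (0, 0, 0)%N) (grid p q r))).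
rewrite -rem_filter ?grid_uniq // size_rem ?mem_grid // !size_allpairs !size_iota.
by rewrite mulnA subn1.
Qed.

Lemma allrel_flattenr (A B : Type) (r : A -> B -> bool) xs yss :
  allrel r xs (flatten yss) = all (allrel r xs) yss.
Proof. by elim: yss => [|ys yss IH] /=; rewrite ?allrel0r // allrel_catr IH. Qed.

Lemma pairwise_flatten_map (A B : Type) (r : B -> B -> bool) (f : A -> seq B) s :
  pairwise (fun x y => allrel r (f x) (f y)) s -> all (fun x => pairwise r (f x)) s ->
  pairwise r (flatten [seq f x | x <- s]).
Proof.
elim: s => //= x s IH /andP[xs ps] /andP[px pf].
by rewrite pairwise_cat allrel_flattenr all_map xs px IH.
Qed.

Section Tiles.
Variable R : realType.
Local Notation C := (R[i]).
Variables dA dB dC n : nat.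
Hypotheses (dAn : (2 * n + 3 <= dA)%N) (dBn : (2 * n + 3 <= dB)%N)
  (dCn : (2 * n + 3 <= dC)%N).
Local Notation tst := (tstate R dA dB dC).
Local Notation tsts := (tstates R dA dB dC).
Local Notation U := (U_set R dA dB dC n).

Lemma U_setE : U = flatten [seq tsts T | T <- tiles dA dB dC n] ++ [:: stopper R dA dB dC].
Proof.
rewrite /U_set catA /tiles map_cat flatten_cat; congr (_ ++ _); congr (_ ++ _).
  elim: (iota 0 n.+1) => //= t s ->; rewrite !catA; congr (_ ++ _).
  rewrite /setA1 /setA2 /setA3 /setB1 /setB2 /setB3 /tstates /=.
  rewrite !triples12 !triples13 !triples23 -!map_comp -!catA /=.
  by do ![congr cat]; apply: eq_map => x; rewrite /= ?eta_chi ?xi_chi ket_chi.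
by rewrite /= cats0; apply: eq_map => x; rewrite !beta_chi.
Qed.

Definition idisj (I J : nat * nat) := ((I.1 + I.2 <= J.1) || (J.1 + J.2 <= I.1))%N.
Definition tdisj (T T' : tile) :=
  [|| idisj T.1.1 T'.1.1, idisj T.1.2 T'.1.2 | idisj T.2 T'.2].

Definition valid (T : tile) :=
  [&& T.1.1.1 + T.1.1.2 <= dA, T.1.2.1 + T.1.2.2 <= dB, T.2.1 + T.2.2 <= dC,
      0 < T.1.1.2, 0 < T.1.2.2 & 0 < T.2.2]%N.

Definition off_corners (T : tile) :=
  [|| 0 < T.1.1.1, 0 < T.1.2.1 | 0 < T.2.1]%N &&
  [|| T.1.1.1 + T.1.1.2 < dA, T.1.2.1 + T.1.2.2 < dB | T.2.1 + T.2.2 < dC]%N.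

Lemma mem_tiles T : (T \in tiles dA dB dC n) =
  (T == core_tile dA dB dC n) || has (fun t => T \in layer dA dB dC t) (iota 0 n.+1).
Proof.
rewrite mem_cat mem_seq1 orbC; congr (_ || _).
apply/flatten_mapP/hasP => [[t tn TL]|[t tn TL]]; by exists t.
Qed.

Lemma tiles_ind (P : tile -> Prop) : P (core_tile dA dB dC n) ->
  (forall t T, (t <= n)%N -> T \in layer dA dB dC t -> P T) ->
  {in tiles dA dB dC n, forall T, P T}.
Proof.
move=> Pc PL T; rewrite mem_tiles => /orP[/eqP -> //|/hasP[t]].
by rewrite mem_iota => tn; apply: PL; rewrite -ltnS.
Qed.

Lemma tiles_valid : {in tiles dA dB dC n, forall T, valid T}.
Proof.
apply: tiles_ind => [|t T tn]; first by rewrite /valid /=; lia.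
by rewrite !inE; do ![case/orP] => /eqP -> /=; rewrite /valid /=; lia.
Qed.

Lemma tiles_off_corners : {in tiles dA dB dC n, forall T, off_corners T}.
Proof.
apply: tiles_ind => [|t T tn]; first by rewrite /off_corners /=; lia.
by rewrite !inE; do ![case/orP] => /eqP -> /=; rewrite /off_corners /=; lia.
Qed.

(** [on_shell t] separates a tile from the box that remains inside layer [t], [in_box t] places it
    in the box whose border is layer [t]. As the boxes are nested, tiles of different layers are
    disjoint. *)
Definition on_shell t (T : tile) :=
  [|| idisj T.1.1 (t.+1, dA - 2 * t - 2)%N, idisj T.1.2 (t.+1, dB - 2 * t - 2)%N
    | idisj T.2 (t.+1, dC - 2 * t - 2)%N].
Definition in_box t (T : tile) :=
  [&& t <= T.1.1.1, T.1.1.1 + T.1.1.2 <= dA - t, t <= T.1.2.1,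
      T.1.2.1 + T.1.2.2 <= dB - t, t <= T.2.1 & T.2.1 + T.2.2 <= dC - t]%N.

Lemma layer_on_shell t T : (t <= n)%N -> T \in layer dA dB dC t -> on_shell t T.
Proof.
move=> tn; rewrite !inE; do ![case/orP] => /eqP ->;
  rewrite /on_shell /idisj /=; lia.
Qed.

Lemma layer_in_box t T : (t <= n)%N -> T \in layer dA dB dC t -> in_box t T.
Proof.
by move=> tn; rewrite !inE; do ![case/orP] => /eqP ->; rewrite /in_box /=; lia.
Qed.

Lemma shell_box_disj t T T' : (t <= n)%N -> on_shell t T -> in_box t.+1 T' -> tdisj T T'.
Proof.
move=> tn; rewrite /on_shell /in_box /tdisj /idisj /= => S.
case/and5P=> b1 b2 b3 b4 /andP[b5 b6].
by case/or3P: S => S; apply/or3P;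
  [apply: Or31|apply: Or32|apply: Or33]; move: S b1 b2 b3 b4 b5 b6; lia.
Qed.

Lemma in_boxW t t' T : (t <= t')%N -> in_box t' T -> in_box t T.
Proof. by move=> tt; rewrite /in_box; lia. Qed.

Lemma core_in_box : in_box n.+1 (core_tile dA dB dC n).
Proof. by rewrite /in_box /=; lia. Qed.

Lemma layer_pairwise t : (t <= n)%N -> pairwise tdisj (layer dA dB dC t).
Proof.
by move=> tn; rewrite /= /tdisj /idisj /= !andbT; repeat (apply/andP; split); lia.
Qed.

Lemma tiles_pairwise : pairwise tdisj (tiles dA dB dC n).
Proof.
rewrite pairwise_cat andbT; apply/andP; split.
  rewrite allrel1r; apply/allP => T /flatten_mapP[t].
  rewrite mem_iota => tn TL; have {}tn : (t <= n)%N by rewrite -ltnS.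
  apply: (shell_box_disj tn (layer_on_shell tn TL)).
  exact: (in_boxW (t' := n.+1)) core_in_box.
apply: pairwise_flatten_map; last first.
  by apply/allP => t; rewrite mem_iota => tn; apply: layer_pairwise; rewrite -ltnS.
have : pairwise ltn (iota 0 n.+1) by rewrite -sorted_pairwise ?iota_ltn_sorted //; exact: ltn_trans.
apply: (sub_in_pairwise (P := [pred t | (t <= n)%N])); last first.
  by apply/allP => t; rewrite mem_iota => tn; rewrite inE -ltnS.
move=> t t' tn t'n /= tt'; apply/allrelP => T T' TL TL'.
apply: (shell_box_disj tn (layer_on_shell tn TL)).
exact: (in_boxW (t' := t')) (layer_in_box t'n TL').
Qed.
End Tiles.

Lemma dotp_tens3 (R : realType) dA dB dC (a a' : cvec R 'I_dA) (b b' : cvec R 'I_dB)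
    (c c' : cvec R 'I_dC) :
  dotp (tens3 a b c) (tens3 a' b' c') = dotp a a' * dotp b b' * dotp c c'.
Proof.
rewrite -!dotp_tens2; apply: eq_bigr => p _.
by rewrite !tens2E !ffunE.
Qed.

(** * Orthogonality, cardinality and incompleteness of the set *)

Section ProductBasis.
Variable R : realType.
Local Notation C := (R[i]).
Variables dA dB dC n : nat.
Hypotheses (dAn : (2 * n + 3 <= dA)%N) (dBn : (2 * n + 3 <= dB)%N)
  (dCn : (2 * n + 3 <= dC)%N).
Local Notation tst := (tstate R dA dB dC).
Local Notation tsts := (tstates R dA dB dC).
Local Notation U := (U_set R dA dB dC n).
Local Notation TT := (tiles dA dB dC n).
Local Notation S := (stopper R dA dB dC).

Lemma dotp_tstate T s1 s2 s3 s1' s2' s3' : valid dA dB dC T ->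
  (s1 < T.1.1.2)%N -> (s2 < T.1.2.2)%N -> (s3 < T.2.2)%N ->
  (s1' < T.1.1.2)%N -> (s2' < T.1.2.2)%N -> (s3' < T.2.2)%N ->
  dotp (tst T s1 s2 s3) (tst T s1' s2' s3') =
  (T.1.1.2 * T.1.2.2 * T.2.2)%:R * ((s1, s2, s3) == (s1', s2', s3'))%:R.
Proof.
case/and5P=> l1 l2 l3 _ _ h1 h2 h3 h1' h2' h3'.
rewrite dotp_tens3 !dotp_chi // !xpair_eqE !natrM.
by case: (s1 == s1'); case: (s2 == s2'); case: (s3 == s3');
  rewrite ?mulr1 ?mulr0 ?mul0r ?mulr0.
Qed.

Lemma dotp_stopper_tstate T s1 s2 s3 : valid dA dB dC T ->
  (s1 < T.1.1.2)%N -> (s2 < T.1.2.2)%N -> (s3 < T.2.2)%N ->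
  (s1, s2, s3) != (0, 0, 0)%N -> dotp S (tst T s1 s2 s3) = 0.
Proof.
case/and5P=> l1 l2 l3 _ _ h1 h2 h3; rewrite !xpair_eqE.
rewrite dotp_tens3 /ones !dotp_ones_chi //.
by case: (s1 == 0)%N; case: (s2 == 0)%N; case: (s3 == 0)%N;
  rewrite ?mulr1 ?mulr0 ?mul0r ?mulr0.
Qed.

Lemma dotp_tdisj T T' s1 s2 s3 s1' s2' s3' : tdisj T T' ->
  dotp (tst T s1 s2 s3) (tst T' s1' s2' s3') = 0.
Proof.
rewrite dotp_tens3 => /or3P[] d.
- by rewrite dotp_chi_disjoint // !mul0r.
- by rewrite [X in _ * X * _]dotp_chi_disjoint // mulr0 mul0r.
by rewrite [X in _ * X]dotp_chi_disjoint // mulr0.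
Qed.

Lemma dotp_stopper : dotp S S = (dA * dB * dC)%:R.
Proof.
rewrite /dotp (eq_bigr (fun=> 1)) => [|p _]; last by rewrite !ffunE !mulr1 rmorph1.
by rewrite sumr_const !card_prod !card_ord.
Qed.

Lemma mem_U u : u \in U <-> u = S \/ exists T s1 s2 s3, [/\ T \in TT,
  (s1 < T.1.1.2)%N /\ (s2 < T.1.2.2)%N, (s3 < T.2.2)%N, (s1, s2, s3) != (0, 0, 0)%N &
  u = tst T s1 s2 s3].
Proof.
rewrite U_setE mem_cat mem_seq1; split.
  case/orP => [/flatten_mapP[T TU /mapP[[[s1 s2] s3] sT ->]]|/eqP ->]; last by left.
  move: sT; rewrite mem_triples => /and4P[s0 h1 h2 h3].
  by right; exists T, s1, s2, s3.
case=> [->|[T [s1 [s2 [s3 [TU [h1 h2] h3 s0 ->]]]]]]; first by rewrite eqxx orbT.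
apply/orP; left; apply/flatten_mapP; exists T => //.
by apply/mapP; exists (s1, s2, s3); rewrite // mem_triples s0 h1 h2.
Qed.

Lemma U_neq0 : {in U, forall u, u != 0}.
Proof.
move=> u /mem_U[->|[T [s1 [s2 [s3 [TU [h1 h2] h3 s0 ->]]]]]]; apply/eqP => u0.
  have := dotp_stopper; rewrite u0 dotp0 => /eqP.
  by rewrite eq_sym pnatr_eq0 !muln_eq0; lia.
have vT := tiles_valid dAn dBn dCn TU.
have := dotp_tstate vT h1 h2 h3 h1 h2 h3; rewrite u0 dotp0 eqxx mulr1 => /eqP.
by move: vT; rewrite eq_sym pnatr_eq0 !muln_eq0 /valid; lia.
Qed.

(** Stated for positions rather than for distinct values, so that absence of repetitions follows
    from it. *)
Lemma U_pairwise : pairwise (fun u v => dotp u v == 0) U.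
Proof.
rewrite U_setE pairwise_cat andbT; apply/andP; split.
  rewrite allrel1r; apply/allP => u /flatten_mapP[T TU /mapP[[[s1 s2] s3] sT ->]].
  move: sT; rewrite mem_triples => /and4P[s0 h1 h2 h3].
  by rewrite dotp_conj dotp_stopper_tstate ?rmorph0 //; apply: (tiles_valid dAn dBn dCn).
apply: pairwise_flatten_map.
  apply: sub_pairwise (tiles_pairwise dAn dBn dCn) => T T' TT'.
  apply/allrelP => u v /mapP[s _ ->] /mapP[s' _ ->].
  by rewrite dotp_tdisj.
apply/allP => T TU; have vT := tiles_valid dAn dBn dCn TU.
rewrite pairwise_map; have := triples_uniq T.1.1.2 T.1.2.2 T.2.2.
rewrite uniq_pairwise; apply: (sub_in_pairwise
  (P := [pred s | s \in triples T.1.1.2 T.1.2.2 T.2.2])); last by apply/allP.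
move=> [[s1 s2] s3] [[s1' s2'] s3'] /=; rewrite !mem_triples.
move=> /and4P[_ h1 h2 h3] /and4P[_ h1' h2' h3'] ss.
by rewrite dotp_tstate // (negPf ss) mulr0.
Qed.

Lemma U_uniq : uniq U.
Proof.
rewrite uniq_pairwise; apply: (sub_in_pairwise (P := [pred u | u != 0])) U_pairwise.
  move=> u v /= u0 _ /eqP uv; apply: contra u0 => /eqP e.
  by apply/eqP/dotpp_eq0; rewrite {2}e.
by apply/allP => u /U_neq0.
Qed.

Lemma U_orth u v : u \in U -> v \in U -> u != v -> dotp u v = 0.
Proof.
move=> uU vU uv; wlog: u v uU vU uv / (index u U < index v U)%N => [H|iuv].
  have [|vu|e] := ltngtP (index u U) (index v U); first exact: H.
    by rewrite dotp_conj H ?rmorph0 // eq_sym.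
  by move: uv; rewrite -(nth_index 0 uU) e nth_index // eqxx.
have /(pairwiseP 0) P := U_pairwise.
by have := P (index u U) (index v U); rewrite !inE !index_mem !nth_index // => /(_ uU vU iuv)/eqP.
Qed.

Definition tile_size (T : tile) := (T.1.1.2 * T.1.2.2 * T.2.2)%N.

(** The 8 is 6 + 2: each of the six tiles lacks its all-ones vector, and two opposite corners of the
    box lie in no tile. *)
Lemma layer_size t : (t <= n)%N ->
  (\sum_(T <- layer dA dB dC t) (tile_size T - 1) + 8 +
    (dA - 2 * t.+1) * (dB - 2 * t.+1) * (dC - 2 * t.+1) =
    (dA - 2 * t) * (dB - 2 * t) * (dC - 2 * t))%N.
Proof.
move=> tn; rewrite !big_cons big_nil /tile_size /=.
have [a aE] : exists a, (dA - 2 * t = a.+2)%N by exists (dA - 2 * t - 2)%N; lia.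
have [b bE] : exists b, (dB - 2 * t = b.+2)%N by exists (dB - 2 * t - 2)%N; lia.
have [c cE] : exists c, (dC - 2 * t = c.+2)%N by exists (dC - 2 * t - 2)%N; lia.
have [a1 b1 c1] : [/\ dA - 2 * t - 1 = a.+1, dB - 2 * t - 1 = b.+1 &
  dC - 2 * t - 1 = c.+1]%N by rewrite aE bE cE !subn1.
have [a2 b2 c2] : [/\ dA - 2 * t.+1 = a, dB - 2 * t.+1 = b &
  dC - 2 * t.+1 = c]%N by move: aE bE cE; clear; split; lia.
rewrite a1 b1 c1 a2 b2 c2 aE bE cE !mul1n !muln1.
have E x y : (x.+1 * y.+1 - 1 = x * y + x + y)%N.
  by rewrite mulSn mulnS; move: (x * y)%N => z; clear; lia.
by rewrite !E; ring.
Qed.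

(** The identities of the layers telescope; the vector missing from the core is made up for by the
    stopper. *)
Lemma U_size : size U = (dA * dB * dC - 8 * (n + 1))%N.
Proof.
have sizes s : all (valid dA dB dC) s ->
    size (flatten [seq tsts T | T <- s]) = (\sum_(T <- s) (tile_size T - 1))%N.
  elim: s => [|T s IH] /=; first by rewrite big_nil.
  case/andP=> /and4P[_ _ _ pos] vs; rewrite size_cat IH // big_cons size_map.
  by rewrite size_triples.
rewrite U_setE size_cat sizes; last first.
  by apply/allP; apply: tiles_valid.
have layers m : (m <= n.+1)%N ->
  (\sum_(T <- flatten [seq layer dA dB dC t | t <- iota 0 m]) (tile_size T - 1) + 8 * m +
    (dA - 2 * m) * (dB - 2 * m) * (dC - 2 * m) = dA * dB * dC)%N.
  elim: m => [|m IH] mn; first by rewrite /= big_nil !muln0 !subn0.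
  have {}IH := IH (ltnW mn).
  have -> : flatten [seq layer dA dB dC t | t <- iota 0 m.+1] =
      flatten [seq layer dA dB dC t | t <- iota 0 m] ++ layer dA dB dC m.
    by rewrite -addn1 iotaD map_cat flatten_cat.
  rewrite big_cat -IH -(layer_size mn) /=.
  set P := ((dA - 2 * m.+1) * (dB - 2 * m.+1) * (dC - 2 * m.+1))%N.
  set Y := (\sum_(_ <- flatten _) _)%N; set Z := (\sum_(_ <- layer _ _ _ _) _)%N.
  by move: P Y Z; clear; lia.
pose s := flatten [seq layer dA dB dC t | t <- iota 0 n.+1].
have -> : (\sum_(T <- tiles dA dB dC n) (tile_size T - 1) =
    \sum_(T <- s) (tile_size T - 1) + (tile_size (core_tile dA dB dC n) - 1))%N.
  by rewrite /tiles -/s; move: s => s; rewrite big_cat big_seq1.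
have := layers n.+1 (leqnn _); rewrite -/s.
have -> : tile_size (core_tile dA dB dC n) =
    ((dA - 2 * n.+1) * (dB - 2 * n.+1) * (dC - 2 * n.+1))%N.
  by rewrite /tile_size /=; congr (_ * _ * _)%N; clear; lia.
have : (0 < (dA - 2 * n.+1) * (dB - 2 * n.+1) * (dC - 2 * n.+1))%N.
  by rewrite !muln_gt0; move: dAn dBn dCn; clear; lia.
set X := ((dA - 2 * n.+1) * (dB - 2 * n.+1) * (dC - 2 * n.+1))%N.
set Z := (dA * dB * dC)%N; set Y := (\sum_(_ <- _) _)%N.
by rewrite /=; move: X Y Z; clear; lia.
Qed.

Lemma tstate_out (T : tile) s1 s2 s3 (p : T3 dA dB dC) :
  [|| p.1.1 \notin segm dA T.1.1.1 T.1.1.2, p.1.2 \notin segm dB T.1.2.1 T.1.2.2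
    | p.2 \notin segm dC T.2.1 T.2.2] -> tst T s1 s2 s3 p = 0.
Proof.
rewrite /tstate /tens3 ffunE => /or3P[] H; rewrite (chi_out R _ H) ?mul0r ?mulr0 //.
by rewrite mul0r.
Qed.

Definition pt (p : T3 dA dB dC) : cvec R (T3 dA dB dC) := [ffun q => (p == q)%:R].

Lemma dotp_pt (u : cvec R (T3 dA dB dC)) p : dotp u (pt p) = conjc (u p).
Proof.
rewrite /dotp -[RHS](sum_delta p (fun q => conjc (u q))).
by apply: eq_bigr => q _; rewrite ffunE.
Qed.

(* No tile contains the corners of the outer box, and the stopper takes equal
   values at the two of them. *)
Lemma U_not_spanning : ~ (forall v : cvec R (T3 dA dB dC),
  exists coef : 'I_(size U) -> C, v = \sum_(i < size U) coef i *: nth 0 U i).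
Proof.
have [a0 b0 c0] : [/\ 0 < dA, 0 < dB & 0 < dC]%N by split; lia.
have [ap bp cp] : [/\ dA.-1 < dA, dB.-1 < dB & dC.-1 < dC]%N by split; lia.
pose p : T3 dA dB dC := (Ordinal a0, Ordinal b0, Ordinal c0).
pose q : T3 dA dB dC := (Ordinal ap, Ordinal bp, Ordinal cp).
pose v := pt p - pt q; have dotpv u : dotp u v = conjc (u p) - conjc (u q).
  rewrite -!dotp_pt /dotp -sumrB; apply: eq_bigr => x _.
  by rewrite !ffunE mulrBr.
have Uv u : u \in U -> dotp u v = 0.
  rewrite dotpv => /mem_U[->|[T [s1 [s2 [s3 [TU _ _ _ ->]]]]]].
    by rewrite !ffunE subrr.
  have /andP[o1 o2] := tiles_off_corners dAn dBn dCn TU.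
  rewrite (tstate_out _ _ _ (p := p)); last first.
    by move: o1; rewrite !inE /=; clear; lia.
  rewrite (tstate_out _ _ _ (p := q)) ?subrr //.
  by move: o2; rewrite !inE /=; move: (a0) (b0) (c0); clear; lia.
move=> /(_ v)[coef vE].
have : dotp v v = 0.
  rewrite {2}vE /dotp; under eq_bigr do rewrite sum_ffunE mulr_sumr.
  rewrite exchange_big big1 // => i _ /=.
  transitivity (coef i * dotp v (nth 0 U i)).
    rewrite /dotp mulr_sumr; apply: eq_bigr => x _; rewrite !ffunE.
    by rewrite mulrCA.
  by rewrite dotp_conj Uv ?mem_nth // rmorph0 mulr0.
move/dotpp_eq0/ffunP/(_ p); rewrite !ffunE eqxx (_ : (q == p) = false).
  by move=> /eqP; rewrite subr0 oner_eq0.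
by apply/negbTE; rewrite !xpair_eqE -!val_eqE /=; move: dAn; clear; lia.
Qed.
End ProductBasis.

(** * Unextendibility *)

Section Pinwheel.
Variable F : idomainType.

(** Constancy of the product $abc$ on a tile determines the factors only if it is nonzero there,
    when the other two can be cancelled; hence the nonzero point. *)
Definition tile_const (X Y Z : finType) (P : pred X) (Q : pred Y) (S : pred Z)
    (a : X -> F) (b : Y -> F) (c : Z -> F) :=
  forall x y z, x \in P -> y \in Q -> z \in S -> a x != 0 -> b y != 0 -> c z != 0 ->
    [/\ {in P, forall x', a x' = a x}, {in Q, forall y', b y' = b y} &
        {in S, forall z', c z' = c z}].

Definition flat (X : finType) (a : X -> F) :=
  forall x y, a x != 0 -> a y != 0 -> a x = a y.

(* [Lo] and [Hi] are the two end points of the support interval of [a], and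
   [E], [W] are that interval without its last, resp. first, point. *)
Record axis (X : finType) (E W Lo Hi : pred X) (a : X -> F) : Prop := Axis {
  axis_lo : exists2 l, l \in Lo & l \in E /\ l \notin W;
  axis_hi : exists2 h, h \in Hi & h \in W /\ h \notin E;
  axis_mid : exists2 m, m \in E & m \in W;
  axis_lo1 : forall x y, x \in Lo -> y \in Lo -> x = y;
  axis_hi1 : forall x y, x \in Hi -> y \in Hi -> x = y;
  axis_loP : forall x, x \in E -> x \notin W -> x \in Lo;
  axis_hiP : forall x, x \in W -> x \notin E -> x \in Hi;
  axis_out : forall x, x \notin E -> x \notin W -> a x = 0 }.

Lemma axis_swap (X : finType) E W Lo Hi (a : X -> F) :
  axis E W Lo Hi a -> axis W E Hi Lo a.
Proof.
case=> lo hi [m mE mW] lo1 hi1 loP hiP out.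
by split => //; [exists m | move=> x xW xE; apply: out].
Qed.

Definition rotor (X Y Z : finType) (EX WX LX HX : pred X) (EY WY LY HY : pred Y)
    (EZ WZ LZ HZ : pred Z) a b c :=
  [/\ tile_const WX LY EZ a b c, tile_const WX EY HZ a b c & tile_const HX WY EZ a b c]
  /\
  [/\ tile_const EX HY WZ a b c, tile_const EX WY LZ a b c & tile_const LX EY WZ a b c].

Lemma tile_const_cyc (X Y Z : finType) (P : pred X) (Q : pred Y) (S : pred Z) a b c :
  tile_const P Q S a b c -> tile_const Q S P b c a.
Proof. by move=> H y z x yQ zS xP b0 c0 a0; have [] := H x y z. Qed.

Lemma rotor_cyc (X Y Z : finType) (EX WX LX HX : pred X) (EY WY LY HY : pred Y)
    (EZ WZ LZ HZ : pred Z) a b c :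
  rotor EX WX LX HX EY WY LY HY EZ WZ LZ HZ a b c ->
  rotor EY WY LY HY EZ WZ LZ HZ EX WX LX HX b c a.
Proof. by move=> [[? ? ?] [? ? ?]]; split; split; apply: tile_const_cyc. Qed.

(** Reversing the three axes exchanges the A tiles and the B tiles. Together with [rotor_cyc] this
    acts transitively on the six tiles, so it is enough to study one of them. *)
Lemma rotor_swap (X Y Z : finType) (EX WX LX HX : pred X) (EY WY LY HY : pred Y)
    (EZ WZ LZ HZ : pred Z) a b c :
  rotor EX WX LX HX EY WY LY HY EZ WZ LZ HZ a b c ->
  rotor WX EX HX LX WY EY HY LY WZ EZ HZ LZ a b c.
Proof. by case. Qed.

Lemma flat_on (X : finType) (P : pred X) (a : X -> F) v :
  {in P, forall x, a x = v} -> (forall x, x \notin P -> a x = 0) -> flat a.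
Proof.
move=> aP a0 x y ax ay.
have xP : x \in P by apply: contraNT ax => /a0/eqP.
have yP : y \in P by apply: contraNT ay => /a0/eqP.
by rewrite !aP.
Qed.

Lemma flat_axis (X : finType) E W Lo Hi (a : X -> F) v : axis E W Lo Hi a ->
  {in E, forall x, a x = v} -> {in W, forall x, a x = v} -> flat a.
Proof.
move=> ax aE aW; apply: (flat_on (P := [predU E & W]) (v := v)).
  by move=> x /orP[/aE|/aW].
by move=> x; rewrite inE negb_or => /andP[xE xW]; apply: (axis_out ax).
Qed.

Definition flat3 (X Y Z : finType) (a : X -> F) (b : Y -> F) (c : Z -> F) :=
  [/\ flat a, flat b & flat c].

Section Layer.
Variables (X Y Z : finType) (EX WX LX HX : pred X) (EY WY LY HY : pred Y)
  (EZ WZ LZ HZ : pred Z) (a : X -> F) (b : Y -> F) (c : Z -> F).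
Hypotheses (xa : axis EX WX LX HX a) (yb : axis EY WY LY HY b)
  (zc : axis EZ WZ LZ HZ c).
Hypothesis rot3 : rotor EX WX LX HX EY WY LY HY EZ WZ LZ HZ a b c.

(* A nonzero point on a tile makes the factors constant there; if the support is
   larger than this tile, the neighbouring tiles propagate to the whole box. *)
Lemma hit_flat x y z : x \in WX -> y \in LY -> z \in EZ ->
  a x != 0 -> b y != 0 -> c z != 0 -> flat3 a b c.
Proof.
case: rot3 => [[A1 A2 A3] [B1 B2 B3]] xW yL zE ax by0 cz.
have [aW _ cE] := A1 x y z xW yL zE ax by0 cz.
have [mx mxE mxW] := axis_mid xa; have [my myE myW] := axis_mid yb.
have [mz mzE mzW] := axis_mid zc.
have [ly lyL [lyE lyW]] := axis_lo yb; have {yL} yl := axis_lo1 yb yL lyL.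
rewrite {}yl in by0; have [lz lzL [lzE lzW]] := axis_lo zc.
have [lx lxL [lxE lxW]] := axis_lo xa.
have [alx|alx] := eqVneq (a lx) 0; last first.
  have cm : c mz != 0 by rewrite cE.
  have [_ bE cW] := B3 lx ly mz lxL lyE mzW alx by0 cm.
  have am : a mx != 0 by rewrite aW.
  have bm : b my != 0 by rewrite bE.
  have cl : c lz != 0 by rewrite cE.
  have [aE bW _] := B2 mx my lz mxE myW lzL am bm cl.
  split.
  - apply: (flat_axis (v := a x) xa) => // x' x'E; rewrite aE //; exact: aW.
  - apply: (flat_axis (v := b ly) yb) => // y' y'W; rewrite bW //; exact: bE.
  apply: (flat_axis (v := c z) zc) => // z' z'W; rewrite cW //; exact: cE.
(* Here the support stays within the tile: a nonzero [b] on [WY] would let [B2] carry the value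
   [a mx] to [lx], and a nonzero [c] on [HZ] would let [A2] carry [b ly] to [my]. *)
have bW0 y' : y' \in WY -> b y' = 0.
  move=> y'W; apply/eqP/negPn/negP => by'.
  have am : a mx != 0 by rewrite aW.
  have cl : c lz != 0 by rewrite cE.
  have [aE _ _] := B2 mx y' lz mxE y'W lzL am by' cl.
  by move: am; rewrite -(aE lx lxE) alx eqxx.
have cH0 z' : z' \in HZ -> c z' = 0.
  move=> z'H; apply/eqP/negPn/negP => cz'.
  have am : a mx != 0 by rewrite aW.
  have [_ bE _] := A2 mx ly z' mxW lyE z'H am by0 cz'.
  by move: by0; rewrite -(bE my myE) bW0 // eqxx.
split.
- apply: (flat_on (P := WX) (v := a x)) => // x' x'W.
  have [x'E|x'E] := boolP (x' \in EX); last exact: (axis_out xa).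
  by rewrite (axis_lo1 xa (axis_loP xa x'E x'W) lxL).
- apply: (flat_on (P := pred1 ly) (v := b ly)) => [y' /eqP -> //|y' y'l].
  have [/bW0 //|y'W] := boolP (y' \in WY).
  have [y'E|y'E] := boolP (y' \in EY); last exact: (axis_out yb).
  by move: y'l; rewrite inE (axis_lo1 yb (axis_loP yb y'E y'W) lyL) eqxx.
apply: (flat_on (P := EZ) (v := c z)) => // z' z'E.
have [z'W|z'W] := boolP (z' \in WZ); last exact: (axis_out zc).
exact: cH0 (axis_hiP zc z'W z'E).
Qed.
End Layer.

Section LayerStep.
Variables (X Y Z : finType) (EX WX LX HX : pred X) (EY WY LY HY : pred Y)
  (EZ WZ LZ HZ : pred Z) (a : X -> F) (b : Y -> F) (c : Z -> F).
Hypotheses (xa : axis EX WX LX HX a) (yb : axis EY WY LY HY b)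
  (zc : axis EZ WZ LZ HZ c).
Hypothesis rot3 : rotor EX WX LX HX EY WY LY HY EZ WZ LZ HZ a b c.

(** Every point of the face at the low end of the first axis lies in one of the B tiles, except the
    corner, which is in no tile. Unless the support is this corner alone, an edge issuing from it
    contains a nonzero point, and that point is in a tile. *)
Lemma lo_flat x y z : x \in LX -> a x != 0 -> b y != 0 -> c z != 0 -> flat3 a b c.
Proof.
move=> xL ax by0 cz.
have [lx lxL [lxE lxW]] := axis_lo xa; rewrite {x xL}(axis_lo1 xa xL lxL) in ax.
have r2 := rotor_cyc rot3; have r3 := rotor_cyc r2.
have hitA1 := hit_flat xa yb zc rot3.
have hitB2 u v w : u \in EX -> v \in WY -> w \in LZ ->
    a u != 0 -> b v != 0 -> c w != 0 -> flat3 a b c.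
  by move=> uE vW wL au bv cw; have [] := hit_flat yb zc xa r2 vW wL uE bv cw au.
have hitB3 u v w : u \in LX -> v \in EY -> w \in WZ ->
    a u != 0 -> b v != 0 -> c w != 0 -> flat3 a b c.
  by move=> uL vE wW au bv cw; have [] := hit_flat zc xa yb r3 wW uL vE cw au bv.
have hitB1 u v w : u \in EX -> v \in HY -> w \in WZ ->
    a u != 0 -> b v != 0 -> c w != 0 -> flat3 a b c.
  exact: (hit_flat (axis_swap xa) (axis_swap yb) (axis_swap zc) (rotor_swap rot3)).
have [zW|zW] := boolP (z \in WZ).
  have [yE|yE] := boolP (y \in EY); first exact: (hitB3 lx y z).
  have [yW|yW] := boolP (y \in WY).
    exact: (hitB1 lx y z lxE (axis_hiP yb yW yE) zW).
  by move: by0; rewrite (axis_out yb) // eqxx.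
have [zE|zE] := boolP (z \in EZ); last by move: cz; rewrite (axis_out zc) // eqxx.
have zL := axis_loP zc zE zW.
have [yW|yW] := boolP (y \in WY); first exact: (hitB2 lx y z).
have [yE|yE] := boolP (y \in EY); last by move: by0; rewrite (axis_out yb) // eqxx.
have yL := axis_loP yb yE yW.
have single (V : finType) (E W Lo Hi : pred V) (g : V -> F) : axis E W Lo Hi g ->
    (forall v, v \in W -> g v = 0) -> flat g.
  move=> ag gW; have [l lL _] := axis_lo ag.
  apply: (flat_on (P := pred1 l) (v := g l)) => [v /eqP -> //|v vl].
  have [/gW //|vW] := boolP (v \in W).
  have [vE|vE] := boolP (v \in E); last exact: (axis_out ag).
  by move: vl; rewrite inE (axis_lo1 ag (axis_loP ag vE vW) lL) eqxx.
have [u /andP[uW au]|aW] := pickP [pred u | (u \in WX) && (a u != 0)].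
  exact: (hitA1 u y z).
have [v /andP[vW bv]|bW] := pickP [pred v | (v \in WY) && (b v != 0)].
  exact: (hitB2 lx v z).
have [w /andP[wW cw]|cW] := pickP [pred w | (w \in WZ) && (c w != 0)].
  exact: (hitB3 lx y w).
split; [apply: single xa _|apply: single yb _|apply: single zc _] => u uW;
  apply/eqP/negPn/negP => gu.
- by have := aW u; rewrite inE uW gu.
- by have := bW u; rewrite inE uW gu.
by have := cW u; rewrite inE uW gu.
Qed.
End LayerStep.

Lemma layer_step (X Y Z : finType) (EX WX LX HX : pred X) (EY WY LY HY : pred Y)
    (EZ WZ LZ HZ : pred Z) (a : X -> F) (b : Y -> F) (c : Z -> F) x y z :
  axis EX WX LX HX a -> axis EY WY LY HY b -> axis EZ WZ LZ HZ c ->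
  rotor EX WX LX HX EY WY LY HY EZ WZ LZ HZ a b c ->
  a x != 0 -> b y != 0 -> c z != 0 ->
  flat3 a b c \/
  [/\ forall u, (u \in LX) || (u \in HX) -> a u = 0,
      forall u, (u \in LY) || (u \in HY) -> b u = 0 &
      forall u, (u \in LZ) || (u \in HZ) -> c u = 0].
Proof.
move=> xa yb zc r1 ax by0 cz.
have r2 := rotor_cyc r1; have r3 := rotor_cyc r2.
have [u /andP[uL au]|aL] := pickP [pred u | ((u \in LX) || (u \in HX)) && (a u != 0)].
  left; case/orP: uL => uL; first exact: (lo_flat xa yb zc r1 uL au by0 cz).
  exact: (lo_flat (axis_swap xa) (axis_swap yb) (axis_swap zc) (rotor_swap r1) uL au by0 cz).
have [u /andP[uL bu]|bL] := pickP [pred u | ((u \in LY) || (u \in HY)) && (b u != 0)].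
  left; suff [] : flat3 b c a by [].
  case/orP: uL => uL; first exact: (lo_flat yb zc xa r2 uL bu cz ax).
  exact: (lo_flat (axis_swap yb) (axis_swap zc) (axis_swap xa) (rotor_swap r2) uL bu cz ax).
have [u /andP[uL cu]|cL] := pickP [pred u | ((u \in LZ) || (u \in HZ)) && (c u != 0)].
  left; suff [] : flat3 c a b by [].
  case/orP: uL => uL; first exact: (lo_flat zc xa yb r3 uL cu ax by0).
  exact: (lo_flat (axis_swap zc) (axis_swap xa) (axis_swap yb) (rotor_swap r3) uL cu ax by0).
right; split=> u uL; apply/eqP/negPn/negP => gu.
- by have := aL u; rewrite inE uL gu.
- by have := bL u; rewrite inE uL gu.
by have := cL u; rewrite inE uL gu.
Qed.
End Pinwheel.

Lemma segm_axis (R : realType) d t (a : cvec R 'I_d) : (2 * t + 3 <= d)%N ->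
  (forall x : 'I_d, ~~ (t <= x < d - t)%N -> a x = 0) ->
  axis (segm d t (d - 2 * t - 1)) (segm d t.+1 (d - 2 * t - 1)) (segm d t 1)
    (segm d (d - 1 - t) 1) a.
Proof.
move=> td a0.
have lP : (t < d)%N by lia.
have hP : (d - 1 - t < d)%N by lia.
have mP : (t.+1 < d)%N by lia.
split.
- by exists (Ordinal lP); rewrite ?inE /=; [|split]; move: td; clear; lia.
- by exists (Ordinal hP); rewrite ?inE /=; [|split]; move: td; clear; lia.
- by exists (Ordinal mP); rewrite ?inE /=; move: td; clear; lia.
- by move=> x y; rewrite !inE => xl yl; apply/val_inj; rewrite /=; move: xl yl; clear; lia.
- by move=> x y; rewrite !inE => xl yl; apply/val_inj; rewrite /=; move: xl yl; clear; lia.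
- by move=> x; rewrite !inE; move: td; clear; lia.
- by move=> x; rewrite !inE; move: td; clear; lia.
by move=> x; rewrite !inE => x1 x2; apply: a0; move: td x1 x2; clear; lia.
Qed.

Section Unextendible.
Variable R : realType.
Local Notation C := (R[i]).
Variables dA dB dC n : nat.
Hypotheses (dAn : (2 * n + 3 <= dA)%N) (dBn : (2 * n + 3 <= dB)%N)
  (dCn : (2 * n + 3 <= dC)%N).
Local Notation U := (U_set R dA dB dC n).
Local Notation TT := (tiles dA dB dC n).
Variables (a : cvec R 'I_dA) (b : cvec R 'I_dB) (c : cvec R 'I_dC).
Hypotheses (a0 : a != 0) (b0 : b != 0) (c0 : c != 0).
Hypothesis orthU : forall u, u \in U -> dotp u (tens3 a b c) = 0.

Lemma tile_const_of_orth (T : tile) : T \in TT ->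
  tile_const (segm dA T.1.1.1 T.1.1.2) (segm dB T.1.2.1 T.1.2.2)
    (segm dC T.2.1 T.2.2) a b c.
Proof.
move=> TU; have vT := tiles_valid dAn dBn dCn TU.
have /and5P[_ _ _ m1 /andP[m2 m3]] := vT.
have N0 : T.1.1.2%:R * T.1.2.2%:R * T.2.2%:R != 0 :> C.
  by rewrite -!natrM pnatr_eq0 !muln_eq0; move: m1 m2 m3; clear; lia.
have tT := tight_tens (tight_tens (@tight_chi R dA T.1.1.1 T.1.1.2)
  (@tight_chi R dB T.1.2.1 T.1.2.2)) (@tight_chi R dC T.2.1 T.2.2).
have cst x y z x' y' z' : x \in segm dA T.1.1.1 T.1.1.2 ->
    y \in segm dB T.1.2.1 T.1.2.2 -> z \in segm dC T.2.1 T.2.2 ->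
    x' \in segm dA T.1.1.1 T.1.1.2 ->
    y' \in segm dB T.1.2.1 T.1.2.2 -> z' \in segm dC T.2.1 T.2.2 ->
    a x * b y * c z = a x' * b y' * c z'.
  move=> xT yT zT x'T y'T z'T.
  pose G (p : 'I_dA * 'I_dB * 'I_dC) := a p.1.1 * b p.1.2 * c p.2.
  apply: (tight_const N0 tT (s0 := (Ordinal m1, Ordinal m2, Ordinal m3)) (F := G)
    (x := (x, y, z)) (y := (x', y', z'))); last 2 first.
  - by rewrite inE /= inE /= xT yT zT.
  - by rewrite inE /= inE /= x'T y'T z'T.
  - move=> [[u v] w] /andP[/andP[/= uT vT'] wT].
    by rewrite !tens2E /= !chi0 ?mulr1.
  move=> [[s1 s2] s3] s0; rewrite -[RHS](orthU (u := tstate R dA dB dC T s1 s2 s3)).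
    by apply: eq_bigr => p _; rewrite !tens2E !ffunE.
  by apply/mem_U; right; exists T, s1, s2, s3; split => //; split.
move=> x y z xT yT zT ax by0 cz; split.
- move=> x' x'T; apply: (mulIf by0); apply: (mulIf cz); exact: cst.
- move=> y' y'T; apply: (mulfI ax); apply: (mulIf cz); exact: cst.
move=> z' z'T; have ab : a x * b y != 0 by rewrite mulf_neq0.
by apply: (mulfI ab); apply: cst.
Qed.

Lemma nonzero_entry d (v : cvec R 'I_d) : v != 0 -> exists x, v x != 0.
Proof.
move=> v0; have [x xv|vz] := pickP [pred x | v x != 0]; first by exists x.
case/eqP: v0; apply/ffunP => x; rewrite ffunE; apply/eqP.
by have := vz x; rewrite inE => /negbFE.
Qed.

Lemma layer_rotor t : (t <= n)%N ->
  let E d := segm d t (d - 2 * t - 1) in let W d := segm d t.+1 (d - 2 * t - 1) in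
  let L d := segm d t 1 in let H d := segm d (d - 1 - t) 1 in
  rotor (E dA) (W dA) (L dA) (H dA) (E dB) (W dB) (L dB) (H dB)
    (E dC) (W dC) (L dC) (H dC) a b c.
Proof.
move=> tn E W L H.
have tc T : T \in layer dA dB dC t -> tile_const (segm dA T.1.1.1 T.1.1.2)
    (segm dB T.1.2.1 T.1.2.2) (segm dC T.2.1 T.2.2) a b c.
  move=> TL; apply: tile_const_of_orth; rewrite mem_tiles; apply/orP; right.
  by apply/hasP; exists t; rewrite // mem_iota.
split; split.
- by apply: (tc ((t.+1, dA - 2 * t - 1), (t, 1), (t, dC - 2 * t - 1))%N);
    rewrite !inE eqxx ?orbT.
- by apply: (tc ((t.+1, dA - 2 * t - 1), (t, dB - 2 * t - 1), (dC - 1 - t, 1))%N);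
    rewrite !inE eqxx ?orbT.
- by apply: (tc ((dA - 1 - t, 1), (t.+1, dB - 2 * t - 1), (t, dC - 2 * t - 1))%N);
    rewrite !inE eqxx ?orbT.
- by apply: (tc ((t, dA - 2 * t - 1), (dB - 1 - t, 1), (t.+1, dC - 2 * t - 1))%N);
    rewrite !inE eqxx ?orbT.
- by apply: (tc ((t, dA - 2 * t - 1), (t.+1, dB - 2 * t - 1), (t, 1))%N);
    rewrite !inE eqxx ?orbT.
by apply: (tc ((t, 1), (t, dB - 2 * t - 1), (t.+1, dC - 2 * t - 1))%N);
    rewrite !inE eqxx ?orbT.
Qed.

(** At [t = 0] the support condition is void; at [t = n.+1] it confines the factors to the core. *)
Lemma shrink t : (t <= n.+1)%N -> flat3 a b c \/
  [/\ forall x : 'I_dA, ~~ (t <= x < dA - t)%N -> a x = 0,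
      forall x : 'I_dB, ~~ (t <= x < dB - t)%N -> b x = 0 &
      forall x : 'I_dC, ~~ (t <= x < dC - t)%N -> c x = 0].
Proof.
elim: t => [|t IH] tn; first by right; split=> x; rewrite subn0 ltn_ord.
have [fl|[aO bO cO]] := IH (ltnW tn); first by left.
have [[x ax] [y by0] [z cz]] := And3 (nonzero_entry a0) (nonzero_entry b0) (nonzero_entry c0).
have [tA tB tC] : [/\ 2 * t + 3 <= dA, 2 * t + 3 <= dB & 2 * t + 3 <= dC]%N.
  by move: tn dAn dBn dCn; clear; split; lia.
have [fl|[aB bB cB]] := layer_step (segm_axis tA aO) (segm_axis tB bO) (segm_axis tC cO)
  (layer_rotor tn) ax by0 cz; first by left.
have ext d (v : cvec R 'I_d) : (2 * t + 3 <= d)%N ->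
    (forall x : 'I_d, ~~ (t <= x < d - t)%N -> v x = 0) ->
    (forall u, (u \in segm d t 1) || (u \in segm d (d - 1 - t) 1) -> v u = 0) ->
    forall x : 'I_d, ~~ (t.+1 <= x < d - t.+1)%N -> v x = 0.
  move=> td vO vB w wO.
  have [wI|wI] := boolP (t <= w < d - t)%N; last exact: vO.
  by apply: vB; rewrite !inE; move: td wO wI; clear; lia.
by right; split; apply: ext.
Qed.

Lemma all_flat : flat3 a b c.
Proof.
have [//|[aO bO cO]] := shrink (leqnn n.+1).
have [[x ax] [y by0] [z cz]] := And3 (nonzero_entry a0) (nonzero_entry b0) (nonzero_entry c0).
have inc d (v : cvec R 'I_d) : (2 * n + 3 <= d)%N ->
    (forall x : 'I_d, ~~ (n.+1 <= x < d - n.+1)%N -> v x = 0) ->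
    forall w, w \notin segm d n.+1 (d - 2 * n - 2) -> v w = 0.
  by move=> nd vO w; rewrite inE => wO; apply: vO; move: nd wO; clear; lia.
have cT : core_tile dA dB dC n \in TT by rewrite mem_tiles eqxx.
have [aI bI cI] := And3 (inc _ _ dAn aO) (inc _ _ dBn bO) (inc _ _ dCn cO).
have [|||aE bE cE] := tile_const_of_orth cT _ _ _ ax by0 cz.
- by apply: contraNT ax => /aI/eqP.
- by apply: contraNT by0 => /bI/eqP.
- by apply: contraNT cz => /cI/eqP.
by split; [apply: flat_on aE aI|apply: flat_on bE bI|apply: flat_on cE cI].
Qed.

(** The sum is the number of nonzero entries times their common value, and the characteristic is
    zero. *)
Lemma flat_sum d (v : cvec R 'I_d) : v != 0 -> flat v -> dotp (ones R d) v != 0.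
Proof.
move=> /nonzero_entry[x vx] fv.
have -> : dotp (ones R d) v = #|[pred y | v y != 0]|%:R * v x.
  rewrite /dotp (bigID [pred y | v y != 0]) /= [X in _ + X]big1 ?addr0.
    rewrite (eq_bigr (fun=> v x)) => [|y vy]; first by rewrite sumr_const mulr_natl.
    by rewrite ffunE rmorph1 mul1r; apply: fv.
  by move=> y /negPn/eqP ->; rewrite mulr0.
rewrite mulf_neq0 // pnatr_eq0 -lt0n; apply/card_gt0P.
by exists x; rewrite inE.
Qed.

Lemma unextendible : False.
Proof.
have [fa fb fc] := all_flat.
have := orthU (u := stopper R dA dB dC); rewrite dotp_tens3 => H.
have /eqP : dotp (ones R dA) a * dotp (ones R dB) b * dotp (ones R dC) c = 0.
  by apply: H; apply/mem_U; left.
by rewrite !mulf_eq0 !(negPf (flat_sum _ _)).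
Qed.
End Unextendible.

Theorem theorem1 (R : realType) (dA dB dC n : nat) :
  (3 <= dA)%N -> (dA <= dB)%N -> (dB <= dC)%N -> (n <= (dA - 3)./2)%N ->
  is_UPB (U_set R dA dB dC n) /\
  strongly_nonlocal (U_set R dA dB dC n) /\
  size (undup (U_set R dA dB dC n)) = (dA * dB * dC - 8 * (n + 1))%N.
Proof.
move=> dA3 dAB dBC nA.
have dAn : (2 * n + 3 <= dA)%N by move: dA3 nA; clear; lia.
have dBn : (2 * n + 3 <= dB)%N := leq_trans dAn dAB.
have dCn : (2 * n + 3 <= dC)%N := leq_trans dBn dBC.
have chi_nz d l m s : (l + m <= d)%N -> (0 < m)%N -> chi R d l m s != 0.
  move=> lmd m0; have ld : (l < d)%N by move: lmd m0; clear; lia.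
  have lI : Ordinal ld \in segm d l m by rewrite inE /=; move: m0; clear; lia.
  by apply: contraNneq (chi_neq0 R s lI) => ->; rewrite ffunE.
have ones_nz d : (2 * n + 3 <= d)%N -> ones R d != 0.
  move=> nd; have d0 : (0 < d)%N by move: nd; clear; lia.
  by apply/eqP => /ffunP/(_ (Ordinal d0))/eqP; rewrite !ffunE oner_eq0.
split; [split|split].
- move=> v /mem_U[->|[T [s1 [s2 [s3 [TU _ _ _ ->]]]]]].
    by exists (ones R dA), (ones R dB), (ones R dC); split=> //; apply: ones_nz.
  have /and5P[lA lB lC mA /andP[mB mC]] := tiles_valid dAn dBn dCn TU.
  exists (chi R dA T.1.1.1 T.1.1.2 s1), (chi R dB T.1.2.1 T.1.2.2 s2),
    (chi R dC T.2.1 T.2.2 s3).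
  by split=> //; apply: chi_nz.
- exact: U_orth.
- exact: U_not_spanning.
- by move=> a b c a0 b0 c0; apply: unextendible.
- apply: strongly_nonlocal_layer.
  + exact: dA3.
  + exact: leq_trans dA3 dAB.
  + exact: leq_trans dA3 (leq_trans dAB dBC).
  + move=> T s1 s2 s3 TL h1 h2 h3 s0; apply/mem_U; right; exists T, s1, s2, s3.
    split=> //; rewrite mem_tiles; apply/orP; right; apply/hasP; by exists 0%N.
  + by apply/mem_U; left.
  + exact: U_neq0.
by rewrite undup_id ?U_uniq ?U_size.
Qed.
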